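(* Let $\alpha$ be a product partial action of a group $G$ on an algebra $A$ with a minimal globalization $\beta$ acting on an algebra $B$. Then $A\rtimes_\alpha G$ and $B\rtimes_\beta G$ are graded-equivalent.
   Context: Algebras are associative, not necessarily unital, over a fixed commutative associative unital ring $k$; $G$ is an arbitrary group. Products of subsets such as $UV$ denote the $k$-span of all products $uv$. An algebra $A$ is idempotent if $A^2=A$. A bimodule ${}_RM_S$ is unital if $RM=M=MS$. A product partial action $\alpha$ of $G$ on an algebra $A$ is a family of two-sided ideals $D_t$ of $A$ and algebra isomorphisms $\alpha_t:D_{t^{-1}}\to D_t$ ($t\in G$) such that for all $s,t\in G$: (1) $\alpha_1$ is the identity $A\to A$ (so $D_1=A$); (2) $D_t^2=D_t$ and $D_sD_t=D_tD_s$; (3) $\alpha_s(D_{s^{-1}}D_t)=D_sD_{st}$; (4) $\alpha_s(\alpha_t(x))=\alpha_{st}(x)$ for $x\in D_{t^{-1}}D_{(st)^{-1}}$. Its skew group algebra is $A\rtimes_\alpha G=\bigoplus_{t\in G}D_t\delta_t$ with $(a\delta_r)(b\delta_s)=\alpha_r(\alpha_r^{-1}(a)b)\delta_{rs}$, $G$-graded with $D_t\delta_t$ in degree $t$. A global action is an action of $G$ by algebra automorphisms; its skew group algebra is given by the same formula with all $D_t=B$. If $A$ is an idempotent two-sided ideal of $B$ and $\beta$ is a global action of $G$ on $B$ with $A\beta_t(A)=\beta_t(A)A$ for all $t$, then $D_t:=A\beta_t(A)$, $\alpha_t:=\beta_t|_{D_{t^{-1}}}$ defines a product partial action on $A$,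 called the restriction of $\beta$ to $A$; $\beta$ (and any global action isomorphic to it) is then called a globalization of $\alpha$. It is minimal if $B=\sum_{t\in G}\beta_t(A)$. A Morita context $(A,B,X,Y,\tau_A,\tau_B)$ consists of algebras $A,B$, an $(A,B)$-bimodule $X$, a $(B,A)$-bimodule $Y$, an $A$-bimodule map $\tau_A:X\otimes_BY\to A$ and a $B$-bimodule map $\tau_B:Y\otimes_AX\to B$ with $\tau_A(x\otimes y)x'=x\tau_B(y\otimes x')$ and $\tau_B(y\otimes x)y'=y\tau_A(x\otimes y')$. It is a graded Morita context between idempotent $G$-graded algebras $A,B$ if $X=\bigoplus_tX_t$, $Y=\bigoplus_tY_t$ are $G$-graded bimodules, and $\tau_A(X_r\otimes_B Y_s)\subseteq A_{rs}$, $\tau_B(Y_r\otimes_A X_s)\subseteq B_{rs}$ for all $r,s\in G$. Two idempotent $G$-graded algebras are graded-equivalent if there is a graded Morita context between them with unital bimodules $X,Y$ and surjective $\tau_A,\tau_B$. *)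

(* Defs.v *)
From HB Require Import structures.
From mathcomp Require Import all_boot ssralg.
From mathcomp Require Import finmap.
From mathcomp Require Import boolp classical_sets functions cardinality fsbigop.

Set Implicit Arguments.
Unset Strict Implicit.
Unset Printing Implicit Defensive.

Import GRing.Theory.
Local Open Scope classical_set_scope.
Local Open Scope ring_scope.

(* [nualgType R]: associative, not necessarily unital, R-algebras.  The product
   is that of [semigroupType] (so [mulgA] applies), hence [x ** y] is printed
   [(x * y)%g]. *)

Notation "x ** y" := (monoid.mul x y)
  (at level 40, left associativity, only parsing) : ring_scope.

Definition bilinear_map (R : pzRingType) (U V W : lmodType R)
    (f : U -> V -> W) : Prop :=
  (forall u, linear (f u)) /\ (forall v, linear (f^~ v)).

HB.mixin Record isNUAlgebra (R : pzRingType) A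
    of Semigroup A & GRing.Lmodule R A := {
  mul_bilinear : bilinear_map (monoid.mul : A -> A -> A)
}.

#[short(type="nualgType")]
HB.structure Definition NUAlgebra (R : pzRingType) :=
  {A of Semigroup A & GRing.Lmodule R A & isNUAlgebra R A}.

Section Submodules.
Variables (R : pzRingType) (V : lmodType R).

Definition is_submodule (S : set V) : Prop :=
  S 0 /\ forall (a : R) u v, S u -> S v -> S (a *: u + v).

Record submodule := Submodule {
  submodule_set :> V -> Prop;
  submoduleP : is_submodule submodule_set
}.

Definition span (X : set V) : set V :=
  [set v | exists (n : nat) (c : 'I_n -> R) (x : 'I_n -> V),
     (forall i, X (x i)) /\ v = \sum_(i < n) c i *: x i].

Lemma submodule_setT : is_submodule [set: V].
Proof. by []. Qed.

Lemma span_submodule (X : set V) : is_submodule (span X).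
Proof.
split; first by exists 0%N, (fun=> 0), (fun=> 0); split; [case|rewrite big_ord0].
move=> a _ _ [n [c [x [Xx ->]]]] [m [d [y [Xy ->]]]].
pose z i := match fintype.split i with inl j => x j | inr j => y j end.
pose e i := match fintype.split i with inl j => a * c j | inr j => d j end.
exists (n + m)%N, e, z; split.
  by move=> i; rewrite /z; case: fintype.split.
rewrite big_split_ord scaler_sumr /=; congr (_ + _); apply: eq_bigr => i _.
- by rewrite /e /z (unsplitK (inl i)) scalerA.
- by rewrite /e /z (unsplitK (inr i)).
Qed.

Lemma sub_span (X : set V) : X `<=` span X.
Proof.
move=> x Xx; exists 1%N, (fun=> 1), (fun=> x); split=> //.
by rewrite big_ord1 scale1r.
Qed.

Lemma submodule_sum (S : set V) (I : Type) (r : seq I) (P : pred I)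
    (F : I -> V) : is_submodule S -> (forall i, S (F i)) ->
  S (\sum_(i <- r | P i) F i).
Proof.
move=> [S0 SD] SF; elim/big_rec: _ => // i x _ Sx.
by rewrite -[F i]scale1r; apply: SD.
Qed.

Lemma submoduleZ (S : set V) a u : is_submodule S -> S u -> S (a *: u).
Proof. by move=> [S0 SD] Su; rewrite -[_ *: _]addr0; apply: SD. Qed.

Lemma submoduleD (S : set V) u v : is_submodule S -> S u -> S v -> S (u + v).
Proof. by move=> [S0 SD] Su Sv; rewrite -[u]scale1r; apply: SD. Qed.

Lemma span_min (X S : set V) : is_submodule S -> X `<=` S -> span X `<=` S.
Proof.
move=> Ssub XS _ [n [c [x [Xx ->]]]]; apply: submodule_sum => // i.
by apply: submoduleZ => //; exact: XS.
Qed.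

End Submodules.

(* [\sum_(i \in setT) f i] is 0 by convention when [finite_supp f] fails *)
Definition finite_supp (I : Type) (V : nmodType) (f : I -> V) : Prop :=
  finite_set (f @^-1` [set~ 0]).

Lemma finite_suppP (I : choiceType) (V : nmodType) (f : I -> V) :
  finite_supp f <-> exists A : {fset I}, forall i, i \notin A -> f i = 0.
Proof.
split=> [fin|[A fA]].
  exists (fset_set (f @^-1` [set~ 0])) => i.
  by rewrite in_fset_set// notin_setE /= => /contrapT.
apply: (@sub_finite_set _ _ [set` A]) => [i /= fi0|]; last exact: finite_fset.
by apply/negPn/negP => /fA.
Qed.

Definition direct_sum_of (R : pzRingType) (V : lmodType R) (I : choiceType)
    (C : I -> set V) : Prop :=
  (forall i, is_submodule (C i)) /\
  forall v, exists! f : I -> V,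
    [/\ finite_supp f, forall i, C i (f i) & v = \sum_(i \in [set: I]) f i].

Section DirectSum.
Variables (R : pzRingType) (V : lmodType R) (I : choiceType).

Variable D : I -> submodule V.

Definition dsum_pred : pred (I -> V) :=
  fun f => `[< finite_supp f /\ forall i, D i (f i) >].

(* external direct sum: the [D i] may overlap in [V] *)
Record dsum := Dsum { dsum_val :> I -> V; _ : dsum_pred dsum_val }.

HB.instance Definition _ := [isSub for dsum_val].
HB.instance Definition _ := [Choice of dsum by <:].

Fact dsum_closed : GRing.submod_closed dsum_pred.
Proof.
split.
  apply/asboolP; split; last by move=> i; case: (submoduleP (D i)).
  by apply/finite_suppP; exists fset0.
move=> a f g /asboolP[/finite_suppP[A fA] fD] /asboolP[/finite_suppP[B gB] gD].
apply/asboolP; split; last by move=> i; case: (submoduleP (D i)) => _; apply.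
apply/finite_suppP; exists (A `|` B)%fset => i.
rewrite in_fsetU negb_or => /andP[iA iB].
by rewrite /GRing.add/= /GRing.scale/= fA// gB// scaler0 addr0.
Qed.
HB.instance Definition _ :=
  GRing.isSubmodClosed.Build R (I -> V) dsum_pred dsum_closed.
HB.instance Definition _ := [SubChoice_isSubLmodule of dsum by <:].

Lemma dsum_supp (f : dsum) : finite_supp f.
Proof. by case: f => f /= /asboolP[]. Qed.

Lemma dsum_dom (f : dsum) i : D i (f i).
Proof. by case: f => f /= /asboolP[]. Qed.

Lemma dsumP (f g : dsum) : f =1 g -> f = g.
Proof. by move=> fg; apply/val_inj/funext. Qed.

Lemma dsum0E i : (0 : dsum) i = 0.
Proof. by []. Qed.

Lemma dsumLE (a : R) (f g : dsum) i : (a *: f + g) i = a *: f i + g i.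
Proof. by []. Qed.

Definition dsum_mk (f : I -> V) (fin : finite_supp f)
  (fD : forall i, D i (f i)) : dsum := Dsum (asboolT (conj fin fD)).

Fact delta_supp (t : I) (a : V) :
  finite_supp (fun i => if i == t then a else 0).
Proof.
apply/finite_suppP; exists [fset t]%fset => i.
by rewrite in_fset1 => /negbTE ->.
Qed.

Fact delta_dom (t : I) (a : V) : D t a ->
  forall i, D i (if i == t then a else 0).
Proof.
by move=> Da i; case: eqP => [->//|_]; case: (submoduleP (D i)).
Qed.

Definition delta (t : I) (a : V) (Da : D t a) : dsum :=
  dsum_mk (delta_supp t a) (delta_dom Da).

Definition homogeneous (t : I) : set dsum :=
  [set f | forall i, i != t -> f i = 0].

Lemma dsum_sumE (r : seq I) (F : I -> dsum) i :
  (\sum_(t <- r) F t) i = \sum_(t <- r) F t i.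
Proof.
by elim: r => [|t r IH]; rewrite ?big_nil// !big_cons -IH.
Qed.

Lemma homogeneous_direct : direct_sum_of homogeneous.
Proof.
split=> [t|f].
  split=> // a u v ut vt i it; rewrite dsumLE ut// vt// scaler0 addr0//.
have /finite_suppP[A fA] := (dsum_supp f).
pose F t := delta (dsum_dom f t).
have Fsum (H : I -> dsum) (B : {fset I}) i : (forall t, homogeneous t (H t)) ->
    (forall t, t \notin B -> H t = 0) ->
    (\sum_(t \in [set: I]) H t) i = H i i.
  move=> Hh HB; rewrite (@fsbigTE _ _ _ _ B)// dsum_sumE.
  have [iB|iB] := boolP (i \in B).
    rewrite (big_fsetD1 i)//= big_seq big1 ?addr0// => t.
    by rewrite !inE => /andP[ti _]; apply: Hh; rewrite eq_sym.
  rewrite HB// big_seq big1// => t tB; apply: Hh.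
  by apply: contraNneq iB => ->.
have F0 t : t \notin A -> F t = 0.
  move=> tA; apply/dsumP => i /=; rewrite fA//.
  by case: ifP.
have Fh t : homogeneous t (F t) by move=> i /= /negbTE ->.
exists F; split.
  split=> //; first by apply/finite_suppP; exists A.
  by apply/dsumP => i; rewrite (Fsum F A)//= eqxx.
move=> H [/finite_suppP[B HB] Hh fE]; apply/funext => t.
apply/dsumP => i /=; case: eqP => [->|/eqP it]; last by rewrite Hh.
by rewrite fE (Fsum H B).
Qed.

End DirectSum.

Section Algebras.
Variable R : comPzRingType.

Definition span_product (U V W : lmodType R) (f : U -> V -> W)
    (X : set U) (Y : set V) : set W :=
  span [set f x y | x in X & y in Y].

Definition set_product (A : nualgType R) (X Y : set A) : set A :=
  span_product monoid.mul X Y.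

Definition is_ideal (A : nualgType R) (I : set A) : Prop :=
  is_submodule I /\ forall a x, I x -> I (a ** x) /\ I (x ** a).

Definition idempotent_set (A : nualgType R) (X : set A) : Prop :=
  set_product X X = X.

Definition idempotent_algebra (A : nualgType R) : Prop :=
  idempotent_set [set: A].

Definition alg_morphism_on (A B : nualgType R) (X : set A) (f : A -> B) : Prop :=
  (forall (c : R) x y, X x -> X y -> f (c *: x + y) = c *: f x + f y) /\
  (forall x y, X x -> X y -> f (x ** y) = f x ** f y).

Definition alg_iso_on (A B : nualgType R) (X : set A) (Y : set B)
    (f : A -> B) : Prop :=
  alg_morphism_on X f /\ set_bij X Y f.

Lemma set_product_subl (A : nualgType R) (I X : set A) :
  is_ideal I -> set_product I X `<=` I.
Proof.
move=> [Isub Imul]; apply: span_min => // _ [x Ix [y _ <-]].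
by case: (Imul y x Ix).
Qed.

Lemma set_product_subr (A : nualgType R) (I X : set A) :
  is_ideal I -> set_product X I `<=` I.
Proof.
move=> [Isub Imul]; apply: span_min => // _ [x _ [y Iy <-]].
by case: (Imul x y Iy).
Qed.

Lemma span_sub (V : lmodType R) (X Y : set V) : X `<=` Y -> span X `<=` span Y.
Proof.
move=> XY; apply: span_min; first exact: span_submodule.
by move=> x /XY; apply: sub_span.
Qed.

Lemma set_product_sub (A : nualgType R) (X X' Y Y' : set A) :
  X `<=` X' -> Y `<=` Y' -> set_product X Y `<=` set_product X' Y'.
Proof.
move=> XX YY; apply: span_sub => _ [x Xx [y Yy <-]].
by exists x; [exact: XX|exists y; [exact: YY|]].
Qed.

Lemma set_product_in (A : nualgType R) (X Y : set A) x y :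
  X x -> Y y -> set_product X Y (x ** y).
Proof. by move=> Xx Yy; apply: sub_span; exists x => //; exists y. Qed.

End Algebras.

Section NUTheory.
Variables (R : comPzRingType) (A : nualgType R).
Implicit Types a b : A.

Lemma nu_mulLr a (c : R) b b' : a ** (c *: b + b') = c *: (a ** b) + a ** b'.
Proof. by case: (@mul_bilinear R A) => + _; apply. Qed.

Lemma nu_mulLl (c : R) a a' b : (c *: a + a') ** b = c *: (a ** b) + a' ** b.
Proof. by case: (@mul_bilinear R A) => _; apply. Qed.

End NUTheory.

Record graded_algebra (R : comPzRingType) (G : groupType) := GradedAlgebra {
  ga_alg :> nualgType R;
  ga_comp : G -> set ga_alg;
  ga_direct : direct_sum_of ga_comp;
  ga_mul : forall r s a b, ga_comp r a -> ga_comp s b ->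
    ga_comp (r * s)%g (a ** b)
}.

(* The algebra of formal sums of a delta_t (a in D_t), with product
   (a delta_r)(b delta_s) = (a *_r b) delta_(rs).  This common construction
   gives the skew group algebras of partial and of global actions. *)

Record twist (R : comPzRingType) (G : groupType) (A : nualgType R) := Twist {
  tw_dom : G -> submodule A;
  tw_mul : G -> A -> A -> A;
  tw_linl : forall r (c : R) a a' b, tw_dom r a -> tw_dom r a' ->
    tw_mul r (c *: a + a') b = c *: tw_mul r a b + tw_mul r a' b;
  tw_linr : forall r (c : R) a b b', tw_dom r a ->
    tw_mul r a (c *: b + b') = c *: tw_mul r a b + tw_mul r a b';
  tw_closed : forall r s a b, tw_dom r a -> tw_dom s b ->
    tw_dom (r * s)%g (tw_mul r a b);
  tw_assoc : forall r s t a b c, tw_dom r a -> tw_dom s b -> tw_dom t c ->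
    tw_mul (r * s)%g (tw_mul r a b) c = tw_mul r a (tw_mul s b c)
}.

Section TwistAlgebra.
Variables (R : comPzRingType) (G : groupType) (A : nualgType R).
Variable T : twist G A.

Local Notation D := (tw_dom T).
Local Notation tw := (tw_mul T).

Definition twist_alg := dsum D.

HB.instance Definition _ := GRing.Lmodule.on twist_alg.

Implicit Types f g h : twist_alg.

Lemma tw0l r b : tw r 0 b = 0.
Proof.
have D0 : D r 0 by case: (submoduleP (D r)).
by have := tw_linl (-1) b D0 D0; rewrite scaler0 addr0 scaleN1r addNr.
Qed.

Lemma tw0r r a : D r a -> tw r a 0 = 0.
Proof.
move=> Da.
by have := tw_linr (-1) 0 0 Da; rewrite scaler0 addr0 scaleN1r addNr.
Qed.

Lemma tw_suml r (I : Type) (s : seq I) (F : I -> A) b :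
  (forall i, D r (F i)) ->
  tw r (\sum_(i <- s) F i) b = \sum_(i <- s) tw r (F i) b.
Proof.
move=> DF; elim: s => [|i s IH]; first by rewrite !big_nil tw0l.
rewrite !big_cons -IH -[F i in LHS]scale1r tw_linl// ?scale1r//.
exact: (submodule_sum _ _ (submoduleP _)).
Qed.

Lemma tw_sumr r (I : Type) (s : seq I) (F : I -> A) a :
  D r a -> tw r a (\sum_(i <- s) F i) = \sum_(i <- s) tw r a (F i).
Proof.
move=> Da; elim: s => [|i s IH]; first by rewrite !big_nil tw0r.
by rewrite !big_cons -IH -[F i in LHS]scale1r tw_linr// scale1r.
Qed.

Definition twist_mul_fun f g (t : G) : A :=
  \sum_(r \in [set: G]) tw r (f r) (g (r^-1 * t)%g).

Lemma twist_mul_funE f g (B : {fset G}) t :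
  (forall r, r \notin B -> f r = 0) ->
  twist_mul_fun f g t = \sum_(r <- B) tw r (f r) (g (r^-1 * t)%g).
Proof.
by move=> fB; apply: fsbigTE => r rB; rewrite fB// tw0l.
Qed.

Lemma tw_term_dom f g r t : D t (tw r (f r) (g (r^-1 * t)%g)).
Proof.
rewrite -[X in D X](mulVKg r t).
by apply: tw_closed; apply: dsum_dom.
Qed.

Fact twist_mul_dom f g t : D t (twist_mul_fun f g t).
Proof.
have /finite_suppP[B fB] := dsum_supp f.
rewrite (twist_mul_funE g t fB).
by apply: (submodule_sum _ _ (submoduleP _)) => r; apply: tw_term_dom.
Qed.

Lemma twist_mul_cover f g : exists C : {fset G},
  (forall t, t \notin C -> twist_mul_fun f g t = 0) /\
  (forall r t, t \notin C -> tw r (f r) (g (r^-1 * t)%g) = 0).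
Proof.
have /finite_suppP[B fB] := dsum_supp f.
have /finite_suppP[C gC] := dsum_supp g.
pose E := [fset (r * s)%g | r in B, s in C]%fset.
have H r t : t \notin E -> tw r (f r) (g (r^-1 * t)%g) = 0.
  move=> tE; have [rB|rB] := boolP (r \in B); last by rewrite fB// tw0l.
  rewrite gC ?tw0r//; first exact: dsum_dom.
  apply: contra tE => sC; apply/imfset2P; exists r => //.
  by exists (r^-1 * t)%g => //; rewrite mulVKg.
exists E; split=> // t tE; rewrite (twist_mul_funE g t fB) big1// => r _.
exact: H.
Qed.

Fact twist_mul_supp f g : finite_supp (twist_mul_fun f g).
Proof.
by have [C [HC _]] := twist_mul_cover f g; apply/finite_suppP; exists C.
Qed.

Definition twist_mul f g : twist_alg :=
  dsum_mk (twist_mul_supp f g) (twist_mul_dom f g).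

Fact twist_mulA : associative twist_mul.
Proof.
move=> f g h; apply/dsumP => t.
have /finite_suppP[B fB] := dsum_supp f.
have [C [fgC twC]] := twist_mul_cover f g.
rewrite [LHS](twist_mul_funE _ t fB).
rewrite [RHS](@twist_mul_funE (twist_mul f g) h C t fgC).
under [RHS]eq_bigr => u _.
  rewrite [twist_mul f g u](twist_mul_funE g u fB) tw_suml; last first.
    by move=> r; apply: tw_term_dom.
  over.
rewrite exchange_big /=; apply: eq_bigr => r _.
transitivity (tw r (f r)
    (\sum_(u <- C) tw (r^-1 * u)%g (g (r^-1 * u)%g) (h (u^-1 * t)%g))).
  have [rB|rB] := eqVneq (f r) 0; first by rewrite rB !tw0l.
  have /finite_suppP[E gE] := dsum_supp g.
  have HC u : u \notin (C `|` [fset (r * s)%g | s in E])%fset ->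
      tw (r^-1 * u)%g (g (r^-1 * u)%g) (h (u^-1 * t)%g) = 0.
    rewrite in_fsetU negb_or => /andP[_ uE]; rewrite gE ?tw0l//.
    apply: contra uE => sE; apply/imfsetP; exists (r^-1 * u)%g => //=.
    by rewrite mulVKg.
  have -> : twist_mul_fun g h (r^-1 * t)%g = \sum_(u \in [set: G])
      tw (r^-1 * u)%g (g (r^-1 * u)%g) (h (u^-1 * t)%g).
    have rbij : bijective (fun u => r^-1 * u)%g.
      by exists (fun u => r * u)%g => u; rewrite ?mulKg ?mulVKg.
    rewrite /twist_mul_fun (reindex_fsbigT _ _ rbij).
    by apply: eq_fsbigr => u _; rewrite invgM invgK -mulgA mulVKg.
  rewrite (fsbigTE _ _ HC) !tw_sumr; try exact: dsum_dom.
  rewrite [RHS](big_fset_incl _ (fsubsetUl C [fset (r * s)%g | s in E]%fset))//=.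
  move=> u _ uC.
  rewrite -(@tw_assoc _ _ _ _ _ _ (u^-1 * t)%g); try exact: dsum_dom.
  by rewrite twC// tw0l.
rewrite tw_sumr; last exact: dsum_dom.
apply: eq_bigr => u _.
rewrite -(@tw_assoc _ _ _ _ _ _ (u^-1 * t)%g); try exact: dsum_dom.
by rewrite mulVKg.
Qed.

HB.instance Definition _ := isSemigroup.Build twist_alg twist_mulA.

Fact twist_mul_bilinear :
  bilinear_map (monoid.mul : twist_alg -> twist_alg -> twist_alg).
Proof.
split=> [f c g h|g c f h]; apply/dsumP => t.
  have /finite_suppP[B fB] := dsum_supp f.
  have E k : (f ** k : twist_alg) t = _ := twist_mul_funE k t fB.
  rewrite dsumLE !E scaler_sumr -big_split; apply: eq_bigr => r _ /=.
  by rewrite tw_linr//; exact: dsum_dom.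
have /finite_suppP[B fB] := dsum_supp f.
have /finite_suppP[C hC] := dsum_supp h.
have fU r : r \notin (B `|` C)%fset -> f r = 0.
  by rewrite in_fsetU negb_or => /andP[/fB].
have hU r : r \notin (B `|` C)%fset -> h r = 0.
  by rewrite in_fsetU negb_or => /andP[_ /hC].
have fhU r : r \notin (B `|` C)%fset -> (c *: f + h : dsum D) r = 0.
  by move=> rU; rewrite dsumLE fU// hU// scaler0 addr0.
rewrite dsumLE [LHS](twist_mul_funE _ t fhU).
have -> : (f ** g : twist_alg) t = _ := twist_mul_funE g t fU.
have -> : (h ** g : twist_alg) t = _ := twist_mul_funE g t hU.
rewrite scaler_sumr -big_split; apply: eq_bigr => r _ /=.
by rewrite [X in tw r X _](_ : _ = c *: f r + h r)// tw_linl//; exact: dsum_dom.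
Qed.

HB.instance Definition _ := isNUAlgebra.Build R twist_alg twist_mul_bilinear.

Lemma twist_mul_delta r s a b (Da : D r a) (Db : D s b) :
  (delta Da : twist_alg) ** (delta Db : twist_alg) =
  (delta (tw_closed Da Db) : twist_alg).
Proof.
apply/dsumP => t; rewrite [LHS](@twist_mul_funE _ _ [fset r]%fset); last first.
  by move=> i; rewrite in_fset1 /= => /negbTE ->.
rewrite big_seq_fset1 /= eqxx.
have -> : (r^-1 * t == s)%g = (t == r * s)%g.
  by apply/eqP/eqP => [<-|->]; rewrite ?mulVKg ?mulKg.
by case: ifP => // _; apply: tw0r.
Qed.

Fact twist_homogeneous_mul r s (f g : twist_alg) :
  homogeneous r f -> homogeneous s g -> homogeneous (r * s)%g (f ** g).
Proof.
move=> fr gs t trs.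
rewrite [LHS](@twist_mul_funE _ _ [fset r]%fset); last first.
  by move=> i; rewrite in_fset1; apply: fr.
rewrite big_seq_fset1 gs ?tw0r//; first exact: dsum_dom.
by apply: contraNneq trs => <-; rewrite mulVKg.
Qed.

Definition twist_graded : graded_algebra R G :=
  @GradedAlgebra R G twist_alg (@homogeneous _ _ _ D)
    (homogeneous_direct D) twist_homogeneous_mul.

End TwistAlgebra.

(* [ppa_map t] is a total function of which only the restriction to
   [ppa_dom t^-1] is meaningful. *)
Record product_partial_action (R : comPzRingType) (G : groupType)
    (A : nualgType R) := ProductPartialAction {
  ppa_dom : G -> set A;
  ppa_map : G -> A -> A;
  ppa_ideal : forall t, is_ideal (ppa_dom t);
  ppa_iso : forall t, alg_iso_on (ppa_dom t^-1%g) (ppa_dom t) (ppa_map t);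
  ppa_dom1 : ppa_dom 1%g = [set: A];
  ppa_map1 : forall x, ppa_map 1%g x = x;
  ppa_idem : forall t, idempotent_set (ppa_dom t);
  ppa_comm : forall s t, set_product (ppa_dom s) (ppa_dom t) =
                         set_product (ppa_dom t) (ppa_dom s);
  ppa_image : forall s t,
    ppa_map s @` set_product (ppa_dom s^-1%g) (ppa_dom t) =
    set_product (ppa_dom s) (ppa_dom (s * t)%g);
  ppa_comp : forall s t x,
    set_product (ppa_dom t^-1%g) (ppa_dom (s * t)^-1%g) x ->
    ppa_map s (ppa_map t x) = ppa_map (s * t)%g x
}.

Section SkewPartial.
Variables (R : comPzRingType) (G : groupType) (A : nualgType R).
Variable alpha : product_partial_action G A.

Local Notation D := (ppa_dom alpha).
Local Notation al := (ppa_map alpha).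

Lemma ppa_in_dom r x : D r^-1%g x -> D r (al r x).
Proof. by case: (ppa_iso alpha r) => _ [+ _ _]; apply. Qed.

Lemma ppa_in_domV r x : D r x -> D r^-1%g (al r^-1%g x).
Proof. by move=> Dx; apply: ppa_in_dom; rewrite invgK. Qed.

Lemma ppa_mapK r x : D r^-1%g x -> al r^-1%g (al r x) = x.
Proof.
move=> Dx; rewrite ppa_comp mulVg ?ppa_map1// invg1.
have := Dx; rewrite -{1}(ppa_idem alpha r^-1%g); apply: set_product_sub => //.
by rewrite ppa_dom1.
Qed.

Lemma ppa_mapVK r x : D r x -> al r (al r^-1%g x) = x.
Proof. by move=> Dx; rewrite -{1}[r]invgK ppa_mapK// invgK. Qed.

Lemma ppa_linear r (c : R) x y : D r^-1%g x -> D r^-1%g y ->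
  al r (c *: x + y) = c *: al r x + al r y.
Proof. by case: (ppa_iso alpha r) => -[+ _] _; apply. Qed.

Lemma ppa_linearV r (c : R) x y : D r x -> D r y ->
  al r^-1%g (c *: x + y) = c *: al r^-1%g x + al r^-1%g y.
Proof. by move=> Dx Dy; apply: ppa_linear; rewrite invgK. Qed.

Lemma ppa_mulM r x y : D r^-1%g x -> D r^-1%g y ->
  al r (x ** y) = al r x ** al r y.
Proof. by case: (ppa_iso alpha r) => -[_ +] _; apply. Qed.

Lemma ppa_mulr r x b : D r x -> D r (x ** b).
Proof. by case: (ppa_ideal alpha r) => _ I /(I b)[]. Qed.

Lemma ppa_mull r x b : D r x -> D r (b ** x).
Proof. by case: (ppa_ideal alpha r) => _ I /(I b)[]. Qed.

Definition skew_dom r : submodule A := Submodule (ppa_ideal alpha r).1.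

(* (a delta_r)(b delta_s) = alpha_r(alpha_r^{-1}(a) b) delta_(rs), the inverse
   of alpha_r being alpha_(r^-1) by [ppa_mapK] and [ppa_mapVK] *)
Definition skew_mul r a b := al r (al r^-1%g a ** b).

Fact skew_linl r (c : R) a a' b : skew_dom r a -> skew_dom r a' ->
  skew_mul r (c *: a + a') b = c *: skew_mul r a b + skew_mul r a' b.
Proof.
move=> /= Da Da'; rewrite /skew_mul ppa_linearV// nu_mulLl ppa_linear//;
  exact/ppa_mulr/ppa_in_domV.
Qed.

Fact skew_linr r (c : R) a b b' : skew_dom r a ->
  skew_mul r a (c *: b + b') = c *: skew_mul r a b + skew_mul r a b'.
Proof.
move=> /= Da; rewrite /skew_mul nu_mulLr ppa_linear//;
  exact/ppa_mulr/ppa_in_domV.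
Qed.

Lemma skew_image r s a b : D r a -> D s b ->
  set_product (D r) (D (r * s)%g) (skew_mul r a b).
Proof.
move=> Da Db; rewrite -ppa_image; exists (al r^-1%g a ** b) => //.
by apply: set_product_in => //; apply: ppa_in_domV.
Qed.

Fact skew_closed r s a b : skew_dom r a -> skew_dom s b ->
  skew_dom (r * s)%g (skew_mul r a b).
Proof.
move=> /= Da Db; apply: (set_product_subr (ppa_ideal alpha _)).
exact: skew_image.
Qed.

Lemma ppa_multiplier s x b c : D s b ->
  al s (al s^-1%g (x ** b) ** c) = x ** al s (al s^-1%g b ** c).
Proof.
move=> Db.
pose S := [set b' | D s b' /\
  al s (al s^-1%g (x ** b') ** c) = x ** al s (al s^-1%g b' ** c)].
suff: S b by case.
have Ssub : is_submodule S.
  have zl (y : A) : 0 ** y = 0.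
    by have := nu_mulLl (-1) 0 0 y; rewrite scaler0 addr0 scaleN1r addNr.
  have zr (y : A) : y ** 0 = 0.
    by have := nu_mulLr y (-1) 0 0; rewrite scaler0 addr0 scaleN1r addNr.
  have D0 t : D t 0 by case: (ppa_ideal alpha t) => -[].
  have al0 t : al t 0 = 0.
    have := ppa_linear (-1) (D0 t^-1%g) (D0 t^-1%g).
    by rewrite scaler0 addr0 scaleN1r addNr.
  split; first by split=> //; rewrite !(zl, zr, al0).
  move=> a u v [Du uE] [Dv vE]; split.
    by case: (ppa_ideal alpha s) => -[_ +] _; apply.
  rewrite nu_mulLr !ppa_linearV ?nu_mulLl//; try exact: ppa_mull.
  rewrite !ppa_linear; try by apply/ppa_mulr/ppa_in_domV => //; apply: ppa_mull.
  by rewrite nu_mulLr uE vE.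
have := Db; rewrite -{1}(ppa_idem alpha s); apply: span_min => //.
move=> _ [u Du [v Dv <-]]; split; first exact: ppa_mulr.
have key w : D s w ->
    al s (al s^-1%g (w ** v) ** c) = w ** al s (al s^-1%g v ** c).
  move=> Dw; have Dw' := ppa_in_domV Dw.
  have Dv' := ppa_mulr c (ppa_in_domV Dv).
  by rewrite (ppa_mulM (r := s^-1%g)) ?invgK// -mulgA [LHS]ppa_mulM// ppa_mapVK.
by rewrite mulgA !key ?mulgA//; apply: ppa_mull.
Qed.

Fact skew_assoc r s t a b c : skew_dom r a -> skew_dom s b -> skew_dom t c ->
  skew_mul (r * s)%g (skew_mul r a b) c = skew_mul r a (skew_mul s b c).
Proof.
move=> /= Da Db _; have DVa := ppa_in_domV Da.
pose y := al r^-1%g a ** b.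
have Dy : set_product (D r^-1%g) (D s) y by apply: set_product_in.
have alV : al (r * s)^-1%g (al r y) = al s^-1%g y.
  have DrsE : set_product (D r) (D (r * s)%g) (al r y) by apply: skew_image.
  rewrite invgM -ppa_comp -?invgM ?invgK// ppa_mapK//.
  exact: ppa_mulr.
rewrite {1}/skew_mul [skew_mul r a b]/skew_mul -/y alV.
rewrite -ppa_comp /skew_mul; last first.
  have : set_product (D s^-1%g) (D (s^-1 * r^-1)%g) (al s^-1%g y).
    rewrite -ppa_image invgK ppa_comm; by exists y.
  rewrite -invgM; set I := D s^-1%g; set J := D _ => IJ.
  have : [set z | set_product I J (z ** c)] (al s^-1%g y).
    move: IJ; apply: span_min.
      split.
        have z0 : (0 : A) ** c = 0.
          by have := nu_mulLl (-1) 0 0 c; rewrite scaler0 addr0 scaleN1r addNr.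
        by rewrite /= z0; case: (span_submodule [set u ** v | u in I & v in J]).
      move=> d u v /= IJu IJv; rewrite nu_mulLl.
      by case: (span_submodule [set u ** v | u in I & v in J]) => _; apply.
    move=> _ [u Iu [v Jv <-]] /=; rewrite -mulgA.
    by apply: set_product_in => //; apply: ppa_mulr.
  by [].
by rewrite ppa_multiplier.
Qed.

Definition skew_twist : twist G A :=
  Twist skew_linl skew_linr skew_closed skew_assoc.

Definition partial_skew_algebra : graded_algebra R G := twist_graded skew_twist.

End SkewPartial.

Record global_action (R : comPzRingType) (G : groupType) (B : nualgType R) :=
  GlobalAction {
  gact_map :> G -> B -> B;
  gact_iso : forall t, alg_iso_on [set: B] [set: B] (gact_map t);
  gact1 : forall x, gact_map 1%g x = x;
  gactM : forall s t x, gact_map (s * t)%g x = gact_map s (gact_map t x)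
}.

Section SkewGlobal.
Variables (R : comPzRingType) (G : groupType) (B : nualgType R).
Variable beta : global_action G B.

Lemma gact_mapVK r x : beta r (beta r^-1%g x) = x.
Proof. by rewrite -gactM mulgV gact1. Qed.

Lemma gact_linear r (c : R) x y :
  beta r (c *: x + y) = c *: beta r x + beta r y.
Proof. by case: (gact_iso beta r) => -[+ _] _; apply. Qed.

Lemma gact_mulM r x y : beta r (x ** y) = beta r x ** beta r y.
Proof. by case: (gact_iso beta r) => -[_ +] _; apply. Qed.

Definition gskew_dom (r : G) : submodule B := Submodule (submodule_setT B).

Definition gskew_mul r a b := beta r (beta r^-1%g a ** b).

Fact gskew_linl r (c : R) a a' b : gskew_dom r a -> gskew_dom r a' ->
  gskew_mul r (c *: a + a') b = c *: gskew_mul r a b + gskew_mul r a' b.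
Proof. by move=> _ _; rewrite /gskew_mul gact_linear nu_mulLl gact_linear. Qed.

Fact gskew_linr r (c : R) a b b' : gskew_dom r a ->
  gskew_mul r a (c *: b + b') = c *: gskew_mul r a b + gskew_mul r a b'.
Proof. by move=> _; rewrite /gskew_mul nu_mulLr gact_linear. Qed.

Fact gskew_closed r s a b : gskew_dom r a -> gskew_dom s b ->
  gskew_dom (r * s)%g (gskew_mul r a b).
Proof. by []. Qed.

Fact gskew_assoc r s t a b c : gskew_dom r a -> gskew_dom s b ->
  gskew_dom t c ->
  gskew_mul (r * s)%g (gskew_mul r a b) c = gskew_mul r a (gskew_mul s b c).
Proof.
move=> _ _ _; rewrite /gskew_mul !gact_mulM !gact_mapVK.
by rewrite -!gactM mulgA.
Qed.

Definition gskew_twist : twist G B :=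
  Twist gskew_linl gskew_linr gskew_closed gskew_assoc.

Definition global_skew_algebra : graded_algebra R G := twist_graded gskew_twist.

End SkewGlobal.

Section Globalization.
Variables (R : comPzRingType) (G : groupType) (A B : nualgType R).
Variables (alpha : product_partial_action G A) (beta : global_action G B).

(* As [A] and [B] are distinct types, [iota] identifies [A] with an ideal of [B];
   [alpha] then corresponds to the restriction of [beta] to [range iota].  This
   also covers every global action isomorphic to such a [beta]. *)
Definition is_globalization (iota : A -> B) : Prop :=
  [/\ alg_morphism_on [set: A] iota /\ injective iota,
      is_ideal (range iota) /\ idempotent_set (range iota),
      forall t, set_product (range iota) (beta t @` range iota) =
                set_product (beta t @` range iota) (range iota),
      forall t, iota @` ppa_dom alpha t =
                set_product (range iota) (beta t @` range iota) &
      forall t x, ppa_dom alpha t^-1%g x ->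
                  iota (ppa_map alpha t x) = beta t (iota x)].

Definition minimal_globalization : Prop :=
  exists iota : A -> B, is_globalization iota /\
    [set: B] = span (\bigcup_t (beta t @` range iota)).

End Globalization.

Section QuotientModule.
Variables (R : pzRingType) (V : lmodType R) (W : submodule V).
Local Open Scope quotient_scope.

Definition quot_rel : rel V := fun x y => `[< W (x - y) >].

Fact quot_rel_equiv : equiv_class_of quot_rel.
Proof.
have [W0 WD] := submoduleP W.
have WN x : W x -> W (- x) by move=> Wx; rewrite -scaleN1r; apply: submoduleZ.
split=> [x|x y|y x z]; rewrite /quot_rel.
- by rewrite subrr; apply/asboolP.
- by apply: asbool_equiv_eq; split=> /WN; rewrite opprB.
- move=> /asboolP xy /asboolP yz; apply/asboolP.
  by rewrite -(subrK y x) -addrA; apply: submoduleD.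
Qed.
Canonical quot_equiv := EquivRelPack quot_rel_equiv.

Definition quotmod := {eq_quot quot_equiv}.
HB.instance Definition _ := Choice.on quotmod.
HB.instance Definition _ := EqQuotient.on quotmod.

Lemma quotmodP (x y : V) : \pi_quotmod x = \pi_quotmod y <-> W (x - y).
Proof. by split=> [/eqmodP/asboolP|Wxy]; last exact/eqmodP/asboolP. Qed.

Lemma quotmodW (t : quotmod) : exists x, t = \pi_quotmod x.
Proof. by exists (repr t); rewrite reprK. Qed.

Lemma repr_pi (x : V) : W (repr (\pi_quotmod x) - x).
Proof. by apply/quotmodP; rewrite reprK. Qed.

Definition quot_add (x y : quotmod) : quotmod := \pi_quotmod (repr x + repr y).
Definition quot_opp (x : quotmod) : quotmod := \pi_quotmod (- repr x).
Definition quot_scale (a : R) (x : quotmod) : quotmod := \pi_quotmod (a *: repr x).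

Lemma quot_addE (x y : V) :
  quot_add (\pi_quotmod x) (\pi_quotmod y) = \pi_quotmod (x + y).
Proof.
by apply/quotmodP; rewrite opprD addrACA;
  apply: submoduleD; [exact: submoduleP|exact: repr_pi|exact: repr_pi].
Qed.

Lemma quot_scaleE a (x : V) :
  quot_scale a (\pi_quotmod x) = \pi_quotmod (a *: x).
Proof.
apply/quotmodP; rewrite -scalerBr.
by apply: submoduleZ; [exact: submoduleP|exact: repr_pi].
Qed.

Lemma quot_oppE (x : V) : quot_opp (\pi_quotmod x) = \pi_quotmod (- x).
Proof.
apply/quotmodP; rewrite -opprD -[- (_ - _)]scaleN1r.
by apply: submoduleZ; [exact: submoduleP|exact: repr_pi].
Qed.

Fact quot_addA : associative quot_add.
Proof.
move=> x y z; have [x' ->] := quotmodW x.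
have [y' ->] := quotmodW y; have [z' ->] := quotmodW z.
by rewrite !quot_addE addrA.
Qed.
Fact quot_addC : commutative quot_add.
Proof.
by move=> x y; have [x' ->] := quotmodW x; have [y' ->] := quotmodW y; rewrite !quot_addE addrC.
Qed.
Fact quot_add0 : left_id (\pi_quotmod 0) quot_add.
Proof. by move=> x; have [x' ->] := quotmodW x; rewrite !quot_addE add0r. Qed.
Fact quot_addN : left_inverse (\pi_quotmod 0) quot_opp quot_add.
Proof. by move=> x; have [x' ->] := quotmodW x; rewrite quot_oppE quot_addE addNr. Qed.

HB.instance Definition _ :=
  GRing.isZmodule.Build quotmod quot_addA quot_addC quot_add0 quot_addN.

Lemma pi_addE (x y : V) :
  (\pi_quotmod x : quotmod) + \pi_quotmod y = \pi_quotmod (x + y).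
Proof. exact: quot_addE. Qed.

Fact quot_scaleA a b (x : quotmod) :
  quot_scale a (quot_scale b x) = quot_scale (a * b) x.
Proof. by have [x' ->] := quotmodW x; rewrite !quot_scaleE scalerA. Qed.
Fact quot_scale1 : left_id 1 quot_scale.
Proof. by move=> x; have [x' ->] := quotmodW x; rewrite quot_scaleE scale1r. Qed.
Fact quot_scaleDr : right_distributive quot_scale +%R.
Proof.
move=> a x y; have [x' ->] := quotmodW x; have [y' ->] := quotmodW y.
by rewrite !(pi_addE, quot_scaleE) scalerDr.
Qed.
Fact quot_scaleDl (x : quotmod) : {morph quot_scale^~ x : a b / a + b}.
Proof.
by move=> a b; have [x' ->] := quotmodW x; rewrite /= !(pi_addE, quot_scaleE) scalerDl.
Qed.

HB.instance Definition _ := GRing.Zmodule_isLmodule.Build R quotmod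
  quot_scaleA quot_scale1 quot_scaleDr quot_scaleDl.

Lemma pi_linear : linear (\pi_quotmod : V -> quotmod).
Proof.
by move=> a x y; rewrite -pi_addE -quot_scaleE.
Qed.

Variables (Z : lmodType R) (f : V -> Z).
Hypotheses (f_lin : linear f) (f_ker : forall x, W x -> f x = 0).

Definition quot_lift (t : quotmod) : Z := f (repr t).

Lemma quot_liftE x : quot_lift (\pi_quotmod x) = f x.
Proof.
have fB u v : f (u - v) = f u - f v.
  by rewrite -scaleN1r addrC f_lin scaleN1r addrC.
by apply/eqP; rewrite -subr_eq0 -fB; apply/eqP/f_ker/repr_pi.
Qed.

Lemma quot_lift_linear : linear quot_lift.
Proof.
move=> a x y; have [x' ->] := quotmodW x; have [y' ->] := quotmodW y.
by rewrite -pi_linear !quot_liftE f_lin.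
Qed.

End QuotientModule.

Record bimodule (R : comPzRingType) (A B : nualgType R) := Bimodule {
  bim_car :> lmodType R;
  lact : A -> bim_car -> bim_car;
  ract : bim_car -> B -> bim_car;
  lact_bilinear : bilinear_map lact;
  ract_bilinear : bilinear_map ract;
  lactM : forall a a' x, lact (a ** a') x = lact a (lact a' x);
  ractM : forall x b b', ract x (b ** b') = ract (ract x b) b';
  lractA : forall a x b, ract (lact a x) b = lact a (ract x b)
}.

Section BimoduleNotions.
Variables (R : comPzRingType) (A B : nualgType R).

Definition unital_bimodule (X : bimodule A B) : Prop :=
  span_product (@lact _ _ _ X) [set: A] [set: X] = [set: X] /\
  span_product (@ract _ _ _ X) [set: X] [set: B] = [set: X].

Definition bimodule_map (X Y : bimodule A B) (f : X -> Y) : Prop :=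
  [/\ linear f, forall a x, f (lact a x) = lact a (f x) &
      forall x b, f (ract x b) = ract (f x) b].

Definition regular_bimodule : bimodule A A :=
  @Bimodule R A A A monoid.mul monoid.mul mul_bilinear mul_bilinear
    (fun a a' x => esym (mulgA a a' x)) (@mulgA A)
    (fun a x b => esym (mulgA a x b)).

End BimoduleNotions.

Section Tensor.
Variables (R : comPzRingType) (A B C : nualgType R).
Variables (X : bimodule A B) (Y : bimodule B C).

Definition tensor_full (p : X * Y) : submodule R^o :=
  Submodule (@submodule_setT R R^o).

Definition tensor_free := dsum tensor_full.
HB.instance Definition _ := GRing.Lmodule.on tensor_free.

Definition tensor_gen (x : X) (y : Y) : tensor_free :=
  @delta R R^o (X * Y)%type tensor_full (x, y) 1 I.

Definition tensor_relator : set tensor_free :=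
  [set z | exists (c : R) x x' y,
     z = tensor_gen (c *: x + x') y - (c *: tensor_gen x y + tensor_gen x' y)]
  `|` [set z | exists (c : R) x y y',
     z = tensor_gen x (c *: y + y') - (c *: tensor_gen x y + tensor_gen x y')]
  `|` [set z | exists x b y,
     z = tensor_gen (ract x b) y - tensor_gen x (lact b y)].

Definition tensor_kernel : submodule tensor_free :=
  Submodule (span_submodule tensor_relator).

(* [tensor_free] is the free module on X * Y, so [tensor] is X (x)_B Y: the
   quotient of X (x)_R Y by the elements x b (x) y - x (x) b y. *)
Definition tensor := quotmod tensor_kernel.
HB.instance Definition _ := GRing.Lmodule.on tensor.

Definition tensor_mk (x : X) (y : Y) : tensor :=
  (\pi_(quotmod tensor_kernel) (tensor_gen x y))%qT.

Lemma tensor_mk_bilinear : bilinear_map tensor_mk.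
Proof.
split=> [x c y y'|y c x x']; rewrite /tensor_mk -pi_linear; apply/quotmodP;
  apply: sub_span.
- by left; right; exists c, x, y, y'.
- by left; left; exists c, x, x', y.
Qed.

Lemma tensor_mk_balanced x b y :
  tensor_mk (ract x b) y = tensor_mk x (lact b y).
Proof. by apply/quotmodP; apply: sub_span; right; exists x, b, y. Qed.

Lemma tensor_free_sum (f : tensor_free) (S : {fset X * Y}) :
  (forall p, p \notin S -> f p = 0) ->
  f = \sum_(p <- S) f p *: tensor_gen p.1 p.2.
Proof.
move=> fS; apply/dsumP => q; rewrite dsum_sumE.
have E p : (f p *: tensor_gen p.1 p.2 : tensor_free) q =
    if q == p then f p else 0.
  rewrite -[_ *: _]addr0 dsumLE addr0 /= -surjective_pairing.
  by case: eqP => _; rewrite ?scaler0//; apply: mulr1.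
under eq_bigr do rewrite E.
have [qS|qS] := boolP (q \in S).
  rewrite (big_fsetD1 q)//= eqxx big_seq big1 ?addr0// => p.
  by rewrite !inE eq_sym => /andP[/negbTE ->].
rewrite fS// big_seq big1// => p pS; case: eqP => // qp.
by rewrite qp pS in qS.
Qed.

Lemma tensor_span : span [set tensor_mk x y | x in [set: X] & y in [set: Y]] =
  [set: tensor].
Proof.
apply/seteqP; split=> // t _; have [f ->] := quotmodW t.
have /finite_suppP[S fS] := dsum_supp f.
have pi_sum (r : seq (X * Y)) (F : X * Y -> tensor_free) :
    (\pi_(quotmod tensor_kernel) (\sum_(p <- r) F p) =
     \sum_(p <- r) \pi_(quotmod tensor_kernel) (F p))%qT.
  elim: r => [|p r IH]; first by rewrite !big_nil.
  by rewrite !big_cons -IH -[F p in LHS]scale1r pi_linear scale1r.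
rewrite (tensor_free_sum fS) pi_sum.
apply: (submodule_sum _ _ (span_submodule _)) => p.
rewrite -[X in (\pi_ _ X)%qT]addr0 pi_linear -[X in _ + X](_ : 0 = _) ?addr0//.
apply: submoduleZ; first exact: span_submodule.
by apply: sub_span; exists p.1 => //; exists p.2.
Qed.

Section Lift.
Variables (Z : lmodType R) (phi : X -> Y -> Z).
Hypotheses (phi_bil : bilinear_map phi)
           (phi_bal : forall x b y, phi (ract x b) y = phi x (lact b y)).

Definition free_lift (f : tensor_free) : Z :=
  \sum_(p \in [set: X * Y]) (f p : R) *: phi p.1 p.2.

Lemma free_liftE (f : tensor_free) (S : {fset X * Y}) :
  (forall p, p \notin S -> f p = 0) ->
  free_lift f = \sum_(p <- S) (f p : R) *: phi p.1 p.2.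
Proof. by move=> fS; apply: fsbigTE => p /fS ->; rewrite scale0r. Qed.

Lemma free_lift_linear : linear free_lift.
Proof.
move=> a f g.
have /finite_suppP[S fS] := dsum_supp f.
have /finite_suppP[T gT] := dsum_supp g.
have fU p : p \notin (S `|` T)%fset -> f p = 0.
  by rewrite in_fsetU negb_or => /andP[/fS].
have gU p : p \notin (S `|` T)%fset -> g p = 0.
  by rewrite in_fsetU negb_or => /andP[_ /gT].
have fgU p : p \notin (S `|` T)%fset -> (a *: f + g : tensor_free) p = 0.
  by move=> pU; rewrite [LHS](dsumLE a f g p) fU// gU// scaler0 addr0.
rewrite (free_liftE fgU) (free_liftE fU) (free_liftE gU).
rewrite scaler_sumr -big_split; apply: eq_bigr => p _ /=.
by rewrite scalerA -scalerDl.
Qed.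

Lemma free_lift_gen x y : free_lift (tensor_gen x y) = phi x y.
Proof.
rewrite (@free_liftE _ [fset (x, y)]%fset); last first.
  by move=> p; rewrite in_fset1 /= => /negbTE ->.
by rewrite big_seq_fset1 /= eqxx scale1r.
Qed.

Lemma free_lift_kernel f : tensor_kernel f -> free_lift f = 0.
Proof.
have FB u v : free_lift (u - v) = free_lift u - free_lift v.
  by have := free_lift_linear (-1) v u; rewrite !scaleN1r ![- _ + _]addrC.
have F0 : free_lift 0 = 0 by rewrite -(subrr 0) FB subrr.
apply: (span_min (S := [set f | free_lift f = 0])).
  by split=> //= a u v u0 v0; rewrite free_lift_linear u0 v0 scaler0 addr0.
case: phi_bil => bl br.
move=> z /= [[|]|].
- move=> [c [x [x' [y ->]]]]; rewrite FB free_lift_linear !free_lift_gen.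
  by rewrite br subrr.
- move=> [c [x [y [y' ->]]]]; rewrite FB free_lift_linear !free_lift_gen.
  by rewrite bl subrr.
- by move=> [x [b [y ->]]]; rewrite FB !free_lift_gen phi_bal subrr.
Qed.

Definition tensor_lift : tensor -> Z := quot_lift free_lift.

Lemma tensor_lift_linear : linear tensor_lift.
Proof.
exact: (quot_lift_linear free_lift_linear free_lift_kernel).
Qed.

Lemma tensor_liftE x y : tensor_lift (tensor_mk x y) = phi x y.
Proof.
rewrite -free_lift_gen.
exact: (quot_liftE free_lift_linear free_lift_kernel).
Qed.

End Lift.

Lemma tensor_ext (Z : lmodType R) (f g : tensor -> Z) :
  linear f -> linear g ->
  (forall x y, f (tensor_mk x y) = g (tensor_mk x y)) -> forall t, f t = g t.
Proof.
move=> fl gl fg t.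
suff: span [set tensor_mk x y | x in [set: X] & y in [set: Y]] `<=`
    [set t | f t = g t] by apply; rewrite tensor_span.
have z0 (h : tensor -> Z) : linear h -> h 0 = 0.
  by move=> hl; have := hl (-1) 0 0; rewrite scaler0 addr0 scaleN1r addNr.
apply: span_min.
  by split=> [|a u v /= uE vE]; rewrite /= ?z0// fl gl uE vE.
by move=> _ [x _ [y _ <-]] /=.
Qed.

Definition tensor_lact (a : A) : tensor -> tensor :=
  tensor_lift (fun x y => tensor_mk (lact a x) y).
Definition tensor_ract (t : tensor) (c : C) : tensor :=
  tensor_lift (fun x y => tensor_mk x (ract y c)) t.

Let lact_bil a : bilinear_map (fun x y => tensor_mk (lact a x) y).
Proof.
case: tensor_mk_bilinear => bl br; case: (lact_bilinear X) => ll lr.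
by split=> [x c y y'|y c x x']; rewrite ?bl// ll br.
Qed.

Let lact_bal a x b y :
  tensor_mk (lact a (ract x b)) y = tensor_mk (lact a x) (lact b y).
Proof. by rewrite -lractA tensor_mk_balanced. Qed.

Let ract_bil c : bilinear_map (fun x y => tensor_mk x (ract y c)).
Proof.
case: tensor_mk_bilinear => bl br; case: (ract_bilinear Y) => ll lr.
by split=> [x d y y'|y d x x']; rewrite ?br// lr bl.
Qed.

Let ract_bal c x b y :
  tensor_mk (ract x b) (ract y c) = tensor_mk x (ract (lact b y) c).
Proof. by rewrite tensor_mk_balanced lractA. Qed.

Lemma tensor_lactE a x y :
  tensor_lact a (tensor_mk x y) = tensor_mk (lact a x) y.
Proof. exact: (tensor_liftE (lact_bil a) (lact_bal a)). Qed.

Lemma tensor_ractE c x y :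
  tensor_ract (tensor_mk x y) c = tensor_mk x (ract y c).
Proof. exact: (tensor_liftE (ract_bil c) (ract_bal c)). Qed.

Let lact_lin a : linear (tensor_lact a).
Proof. exact: (tensor_lift_linear (lact_bil a) (lact_bal a)). Qed.

Let ract_lin c : linear (tensor_ract^~ c).
Proof. exact: (tensor_lift_linear (ract_bil c) (ract_bal c)). Qed.

Fact tensor_lact_bilinear : bilinear_map tensor_lact.
Proof.
split=> // t d a a'.
apply: (@tensor_ext _ (tensor_lact (d *: a + a'))
  (fun t => d *: tensor_lact a t + tensor_lact a' t)) => // [e u v|x y] /=.
  rewrite !lact_lin !scalerDr !scalerA [d * e]mulrC -!addrA; congr (_ + _).
  by rewrite addrCA.
rewrite !tensor_lactE; case: (lact_bilinear X) => _ ->.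
by case: tensor_mk_bilinear => _ ->.
Qed.

Fact tensor_ract_bilinear : bilinear_map tensor_ract.
Proof.
split=> // t d c c'.
apply: (@tensor_ext _ (fun t => tensor_ract t (d *: c + c'))
  (fun t => d *: tensor_ract t c + tensor_ract t c')) => // [e u v|x y] /=.
  rewrite !ract_lin !scalerDr !scalerA [d * e]mulrC -!addrA; congr (_ + _).
  by rewrite addrCA.
rewrite !tensor_ractE; case: (ract_bilinear Y) => -> _.
by case: tensor_mk_bilinear => -> _.
Qed.

Fact tensor_lactM a a' t :
  tensor_lact (a ** a') t = tensor_lact a (tensor_lact a' t).
Proof.
apply: (@tensor_ext _ (tensor_lact (a ** a'))
  (fun t => tensor_lact a (tensor_lact a' t))) => // [e u v|x y] /=.
  by rewrite !lact_lin.
by rewrite !tensor_lactE lactM.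
Qed.

Fact tensor_ractM t c c' :
  tensor_ract t (c ** c') = tensor_ract (tensor_ract t c) c'.
Proof.
apply: (@tensor_ext _ (tensor_ract^~ (c ** c'))
  (fun t => tensor_ract (tensor_ract t c) c')) => // [e u v|x y] /=.
  by rewrite !ract_lin.
by rewrite !tensor_ractE ractM.
Qed.

Fact tensor_lractA a t c :
  tensor_ract (tensor_lact a t) c = tensor_lact a (tensor_ract t c).
Proof.
apply: (@tensor_ext _ (fun t => tensor_ract (tensor_lact a t) c)
  (fun t => tensor_lact a (tensor_ract t c))) => [e u v|e u v|x y] /=.
- by rewrite lact_lin ract_lin.
- by rewrite ract_lin lact_lin.
- by rewrite tensor_ractE !tensor_lactE tensor_ractE.
Qed.

Definition tensor_bimodule : bimodule A C :=
  Bimodule tensor_lact_bilinear tensor_ract_bilinear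
    tensor_lactM tensor_ractM tensor_lractA.

End Tensor.

Record morita_context (R : comPzRingType) (A B : nualgType R) :=
  MoritaContext {
  mc_X : bimodule A B;
  mc_Y : bimodule B A;
  mc_tauA : tensor_bimodule mc_X mc_Y -> regular_bimodule A;
  mc_tauB : tensor_bimodule mc_Y mc_X -> regular_bimodule B;
  mc_tauA_map : bimodule_map mc_tauA;
  mc_tauB_map : bimodule_map mc_tauB;
  mc_assocX : forall x y x',
    lact (mc_tauA (tensor_mk x y)) x' = ract x (mc_tauB (tensor_mk y x'));
  mc_assocY : forall y x y',
    lact (mc_tauB (tensor_mk y x)) y' = ract y (mc_tauA (tensor_mk x y'))
}.

Section GradedMorita.
Variables (R : comPzRingType) (G : groupType).

Definition graded_bimodule (A B : graded_algebra R G)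
    (X : bimodule A B) (Xc : G -> set X) : Prop :=
  [/\ direct_sum_of Xc,
      forall r s a x, ga_comp r a -> Xc s x -> Xc (r * s)%g (lact a x) &
      forall r s x b, Xc r x -> ga_comp s b -> Xc (r * s)%g (ract x b)].

(* the image of X_r (x) Y_s in X (x)_B Y *)
Definition tensor_comp (A B C : nualgType R) (X : bimodule A B)
    (Y : bimodule B C) (U : set X) (V : set Y) : set (tensor X Y) :=
  span_product (@tensor_mk R A B C X Y) U V.

Record graded_morita_context (A B : graded_algebra R G) :=
  GradedMoritaContext {
  gmc_idemA : idempotent_algebra A;
  gmc_idemB : idempotent_algebra B;
  gmc_ctx :> morita_context A B;
  gmc_Xc : G -> set (mc_X gmc_ctx);
  gmc_Yc : G -> set (mc_Y gmc_ctx);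
  gmc_X_graded : graded_bimodule gmc_Xc;
  gmc_Y_graded : graded_bimodule gmc_Yc;
  gmc_tauA_graded : forall r s,
    mc_tauA (m := gmc_ctx) @` tensor_comp (gmc_Xc r) (gmc_Yc s)
    `<=` ga_comp (r * s)%g;
  gmc_tauB_graded : forall r s,
    mc_tauB (m := gmc_ctx) @` tensor_comp (gmc_Yc r) (gmc_Xc s)
    `<=` ga_comp (r * s)%g
}.

Definition graded_equivalent (A B : graded_algebra R G) : Prop :=
  exists M : graded_morita_context A B,
    [/\ unital_bimodule (mc_X M), unital_bimodule (mc_Y M),
        forall a : A, exists t, mc_tauA (m := M) t = a &
        forall b : B, exists t, mc_tauB (m := M) t = b].

End GradedMorita.

(* Main.v *)
From HB Require Import structures.
Require Import Defs.
From mathcomp Require Import all_boot ssralg.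
From mathcomp Require Import finmap.
From mathcomp Require Import boolp classical_sets functions cardinality fsbigop.

Set Implicit Arguments.
Unset Strict Implicit.
Unset Printing Implicit Defensive.

Import GRing.Theory.
Local Open Scope classical_set_scope.
Local Open Scope ring_scope.

(** Everything takes place inside S = B x| G, the skew group algebra of the
    globalization.  Write J for the image of A in B and J_t for beta_t(J).  The
    map sending a delta_t to iota(a) delta_t embeds A x| G in S, as the graded
    subalgebra with components (J J_t) delta_t ([skew_emb], [range_skew_emb]):
    it is multiplicative because alpha_t is the restriction of beta_t.  Inside
    S consider
      X = (+)_t J delta_t    and    Y = (+)_t J_t delta_t,
    a right and a left ideal of S which the image of A x| G preserves on the
    other side.  All actions and both pairings of the Morita context are the
    multiplication of S, so every associativity requirement is that of S, and
    everything is graded because S is.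

    What remains is that X Y is the image of A x| G, that Y X = S, and that the
    four actions are unital.  Products of graded submodules of S can be
    computed degree by degree ([fill_product]), since
      (a delta_r)(b delta_s) = a beta_r(b) delta_(rs).
    The degree t part of X Y is then the sum over r of J beta_r(J_(r^-1 t)),
    which is J J_t; that of Y X is the sum over r of J_r J_r = J_r, which is B
    exactly by minimality.  The unital conditions follow in the same way from
    the fact that each J_t is an idempotent ideal of B.  Idempotence of the two
    graded algebras is a consequence of these six equations.

    The passage from the six equations to the graded Morita context is valid
    for any graded embedding in a graded algebra and is isolated as
    [graded_equivalent_embedding]. *)

(** * Linear maps given as bare functions *)

Lemma linear_fun0 (R : pzRingType) (U V : lmodType R) (f : U -> V) :
  linear f -> f 0 = 0.
Proof.
by move=> fl; have := fl (-1) 0 0; rewrite scaler0 addr0 scaleN1r addNr.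
Qed.

Lemma linear_fun_sum (R : pzRingType) (U V : lmodType R) (f : U -> V)
    (I : Type) (r : seq I) (F : I -> U) :
  linear f -> f (\sum_(i <- r) F i) = \sum_(i <- r) f (F i).
Proof.
move=> fl; elim: r => [|i r IH]; rewrite ?big_nil ?big_cons.
  exact: linear_fun0.
by rewrite -IH -[F i]scale1r fl !scale1r.
Qed.

Lemma linear_fun_fsbig (R : pzRingType) (U V : lmodType R) (f : U -> V)
    (I : choiceType) (F : I -> U) :
  linear f -> finite_supp F ->
  f (\sum_(i \in [set: I]) F i) = \sum_(i \in [set: I]) f (F i).
Proof.
move=> fl /finite_suppP[C FC].
rewrite (fsbigTE _ _ FC) (fsbigTE C) ?linear_fun_sum// => i /FC ->.
exact: linear_fun0.
Qed.

Lemma image_submodule (R : pzRingType) (U V : lmodType R) (f : U -> V)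
    (W : set U) : linear f -> is_submodule W -> is_submodule (f @` W).
Proof.
move=> fl [W0 WD]; split; first by exists 0 => //; apply: linear_fun0.
move=> a _ _ [u Wu <-] [v Wv <-]; exists (a *: u + v); last exact: fl.
exact: WD.
Qed.

Lemma preimage_submodule (R : pzRingType) (U V : lmodType R) (f : U -> V)
    (W : set V) : linear f -> is_submodule W -> is_submodule (f @^-1` W).
Proof.
move=> fl [W0 WD]; split; first by rewrite /= linear_fun0.
by move=> a u v Wu Wv; rewrite /= fl; apply: WD.
Qed.

Lemma image_span (R : pzRingType) (U V : lmodType R) (f : U -> V)
    (P : set U) : linear f -> f @` span P = span (f @` P).
Proof.
move=> fl; apply/seteqP; split.
  apply/image_subP.
  apply: (span_min (preimage_submodule fl (span_submodule _))).
  by move=> x Px; apply: sub_span; exists x.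
apply: span_min; first exact: (image_submodule fl (span_submodule _)).
by move=> _ [x Px <-]; exists x => //; apply: sub_span.
Qed.

(** * A submodule as a module, and its grading *)

Section SubmoduleType.
Variables (R : pzRingType) (V : lmodType R) (W : submodule V).

Definition submod_pred : pred V := fun x => `[< W x >].

Record submod_type := Submod { submod_val : V; _ : submod_pred submod_val }.

HB.instance Definition _ := [isSub for submod_val].
HB.instance Definition _ := [Choice of submod_type by <:].

Fact submod_pred_closed : GRing.submod_closed submod_pred.
Proof.
have [W0 WD] := submoduleP W.
by split=> [|a u v /asboolP Wu /asboolP Wv]; apply/asboolP=> //; apply: WD.
Qed.
HB.instance Definition _ :=
  GRing.isSubmodClosed.Build R V submod_pred submod_pred_closed.
HB.instance Definition _ := [SubChoice_isSubLmodule of submod_type by <:].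

Lemma submod_valP (x : submod_type) : W (submod_val x).
Proof. by case: x => x /= /asboolP. Qed.

Lemma submod_val_inj : injective submod_val.
Proof. exact: val_inj. Qed.

Lemma submod_val_linear : linear submod_val.
Proof. by []. Qed.

Definition submod_in x (Wx : W x) : submod_type := Submod (asboolT Wx).

Lemma submod_surj x : W x -> exists y, submod_val y = x.
Proof. by move=> Wx; exists (submod_in Wx). Qed.

End SubmoduleType.

(** W is the sum of its intersections with the C i: the components of an element
    of W lie in W. *)
Definition graded_submodule (R : pzRingType) (V : lmodType R) (I : choiceType)
    (C : I -> set V) (W : submodule V) : Prop :=
  forall f, finite_supp f -> (forall i, C i (f i)) ->
    W (\sum_(i \in [set: I]) f i) -> forall i, W (f i).

(** Decompose in the ambient module: the components stay in W, and uniqueness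
    is inherited because the inclusion is injective. *)
Lemma graded_submodule_direct (R : pzRingType) (V : lmodType R)
    (I : choiceType) (C : I -> set V) (W : submodule V) :
  direct_sum_of C -> graded_submodule C W ->
  direct_sum_of (fun i => [set x : submod_type W | C i (submod_val x)]).
Proof.
move=> [Csub Cdir] Wgr.
have vl := @submod_val_linear _ _ W.
split=> [i|x].
  have [C0 CD] := Csub i.
  by split=> [|a u v /= Cu Cv]; rewrite /= ?vl//; apply: CD.
have [f [[ffin fC fE] funiq]] := Cdir (submod_val x).
have Wf : forall i, W (f i).
  by apply: Wgr => //; rewrite -fE; apply: submod_valP.
pose g i : submod_type W := submod_in (Wf i).
have gfin : finite_supp g.
  move/finite_suppP: ffin => [S fS]; apply/finite_suppP; exists S => i /fS fi.
  exact: submod_val_inj.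
exists g; split.
  by split=> //; apply: submod_val_inj; rewrite (linear_fun_fsbig vl).
move=> h [hfin hC hE]; apply/funext => i; apply: submod_val_inj.
rewrite -[LHS]/(f i) (funiq (fun i => submod_val (h i)))//; split=> //.
  move/finite_suppP: hfin => [S hS]; apply/finite_suppP.
  by exists S => j /hS ->.
by rewrite hE (linear_fun_fsbig vl).
Qed.

(** * The Morita context cut out of an ambient algebra *)

Section Embedding.
Variables (R : comPzRingType) (A S : nualgType R) (phi : A -> S).
Variables X Y : submodule S.
Hypotheses (phi_lin : linear phi)
  (phi_mul : forall a b, phi (a ** b) = phi a ** phi b)
  (phi_inj : injective phi).
Hypotheses (phiX : set_product (range phi) X `<=` X)
  (XS : set_product X [set: S] `<=` X)
  (SY : set_product [set: S] Y `<=` Y)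
  (Yphi : set_product Y (range phi) `<=` Y)
  (XY : set_product X Y `<=` range phi).

Local Notation sX := (submod_type X).
Local Notation sY := (submod_type Y).

Fact lactX_subproof a (x : sX) : X (phi a ** submod_val x).
Proof. by apply/phiX/set_product_in; [exists a|apply: submod_valP]. Qed.
Fact ractX_subproof (x : sX) s : X (submod_val x ** s).
Proof. by apply/XS/set_product_in => //; apply: submod_valP. Qed.
Fact lactY_subproof s (y : sY) : Y (s ** submod_val y).
Proof. by apply/SY/set_product_in => //; apply: submod_valP. Qed.
Fact ractY_subproof (y : sY) a : Y (submod_val y ** phi a).
Proof. by apply/Yphi/set_product_in; [apply: submod_valP|exists a]. Qed.

(** The algebra A acts on X and Y through phi; both bimodules are left
    transparent, as their actions have to compute to products in S. *)
Definition emb_X : bimodule A S.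
Proof.
apply: (@Bimodule R A S sX (fun a x => submod_in (lactX_subproof a x))
  (fun x s => submod_in (ractX_subproof x s))).
- split=> [a c x x'|x c a a']; apply: submod_val_inj => /=.
  + by rewrite nu_mulLr.
  + by rewrite phi_lin nu_mulLl.
- split=> [x c s s'|s c x x']; apply: submod_val_inj => /=.
  + by rewrite nu_mulLr.
  + by rewrite nu_mulLl.
- by move=> a a' x; apply: submod_val_inj; rewrite /= phi_mul mulgA.
- by move=> x s s'; apply: submod_val_inj; rewrite /= mulgA.
- by move=> a x s; apply: submod_val_inj; rewrite /= mulgA.
Defined.

Definition emb_Y : bimodule S A.
Proof.
apply: (@Bimodule R S A sY (fun s y => submod_in (lactY_subproof s y))
  (fun y a => submod_in (ractY_subproof y a))).
- split=> [s c y y'|y c s s']; apply: submod_val_inj => /=.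
  + by rewrite nu_mulLr.
  + by rewrite nu_mulLl.
- split=> [y c a a'|a c y y']; apply: submod_val_inj => /=.
  + by rewrite phi_lin nu_mulLr.
  + by rewrite nu_mulLl.
- by move=> s s' y; apply: submod_val_inj; rewrite /= mulgA.
- by move=> y a a'; apply: submod_val_inj; rewrite /= phi_mul mulgA.
- by move=> s y a; apply: submod_val_inj; rewrite /= mulgA.
Defined.

Fact emb_mulXY_subproof (x : emb_X) (y : emb_Y) :
  exists a, phi a = submod_val x ** submod_val y.
Proof.
suff [a _ aE] : range phi (submod_val x ** submod_val y) by exists a.
by apply/XY/set_product_in; apply: submod_valP.
Qed.

(** The product x y of S, transported back to A along the injection phi. *)
Definition emb_mulXY (x : emb_X) (y : emb_Y) : regular_bimodule A :=
  projT1 (cid (emb_mulXY_subproof x y)).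

Definition emb_mulYX (y : emb_Y) (x : emb_X) : regular_bimodule S :=
  submod_val y ** submod_val x.

Lemma phi_mulXY x y : phi (emb_mulXY x y) = submod_val x ** submod_val y.
Proof. by rewrite /emb_mulXY; case: cid. Qed.

Fact emb_mulXY_bil : bilinear_map emb_mulXY.
Proof.
split=> [x c y y'|y c x x']; apply: phi_inj;
  by rewrite phi_lin !phi_mulXY submod_val_linear ?nu_mulLr ?nu_mulLl.
Qed.

Fact emb_mulYX_bil : bilinear_map emb_mulYX.
Proof.
by split=> [y c x x'|x c y y']; rewrite /emb_mulYX submod_val_linear
  ?nu_mulLr ?nu_mulLl.
Qed.

Fact emb_mulXY_bal x s y :
  emb_mulXY (ract x s) y = emb_mulXY x (lact s y).
Proof. by apply: phi_inj; rewrite !phi_mulXY /= mulgA. Qed.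

Fact emb_mulYX_bal y a x :
  emb_mulYX (ract y a) x = emb_mulYX y (lact a x).
Proof. by rewrite /emb_mulYX /= mulgA. Qed.

Definition emb_tauA : tensor_bimodule emb_X emb_Y -> regular_bimodule A :=
  tensor_lift emb_mulXY.
Definition emb_tauB : tensor_bimodule emb_Y emb_X -> regular_bimodule S :=
  tensor_lift emb_mulYX.

Lemma emb_tauAE x y : emb_tauA (tensor_mk x y) = emb_mulXY x y.
Proof. exact: (tensor_liftE emb_mulXY_bil emb_mulXY_bal). Qed.
Lemma emb_tauBE y x : emb_tauB (tensor_mk y x) = emb_mulYX y x.
Proof. exact: (tensor_liftE emb_mulYX_bil emb_mulYX_bal). Qed.

Lemma emb_tauA_linear : linear emb_tauA.
Proof. exact: (tensor_lift_linear emb_mulXY_bil emb_mulXY_bal). Qed.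
Lemma emb_tauB_linear : linear emb_tauB.
Proof. exact: (tensor_lift_linear emb_mulYX_bil emb_mulYX_bal). Qed.


Fact emb_tauA_map : bimodule_map emb_tauA.
Proof.
have al := emb_tauA_linear.
have [Al Ar] := @mul_bilinear R A.
have [Tl _] := tensor_lact_bilinear emb_X emb_Y.
have [_ Tr] := tensor_ract_bilinear emb_X emb_Y.
split=> // [a t|t a].
  apply: (@tensor_ext _ _ _ _ _ _ _ (fun t => emb_tauA (tensor_lact a t))
    (fun t => a ** emb_tauA t)) => [c u v|c u v|x y].
  - by rewrite Tl al.
  - by rewrite al Al.
  - apply: phi_inj.
    by rewrite tensor_lactE !emb_tauAE phi_mul !phi_mulXY /= mulgA.
apply: (@tensor_ext _ _ _ _ _ _ _ (fun t => emb_tauA (tensor_ract t a))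
  (fun t => emb_tauA t ** a)) => [c u v|c u v|x y].
- by rewrite Tr al.
- by rewrite al Ar.
- apply: phi_inj.
  by rewrite tensor_ractE !emb_tauAE phi_mul !phi_mulXY /= mulgA.
Qed.

Fact emb_tauB_map : bimodule_map emb_tauB.
Proof.
have bl := emb_tauB_linear.
have [Sl Sr] := @mul_bilinear R S.
have [Tl _] := tensor_lact_bilinear emb_Y emb_X.
have [_ Tr] := tensor_ract_bilinear emb_Y emb_X.
split=> // [s t|t s].
  apply: (@tensor_ext _ _ _ _ _ _ _ (fun t => emb_tauB (tensor_lact s t))
    (fun t => s ** emb_tauB t)) => [c u v|c u v|y x].
  - by rewrite Tl bl.
  - by rewrite bl Sl.
  - by rewrite tensor_lactE !emb_tauBE /emb_mulYX /= mulgA.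
apply: (@tensor_ext _ _ _ _ _ _ _ (fun t => emb_tauB (tensor_ract t s))
  (fun t => emb_tauB t ** s)) => [c u v|c u v|y x].
- by rewrite Tr bl.
- by rewrite bl Sr.
- by rewrite tensor_ractE !emb_tauBE /emb_mulYX /= mulgA.
Qed.

Fact emb_assocX x y x' :
  lact (emb_tauA (tensor_mk x y)) x' = ract x (emb_tauB (tensor_mk y x')).
Proof.
by apply: submod_val_inj; rewrite emb_tauAE emb_tauBE /= phi_mulXY mulgA.
Qed.

Fact emb_assocY y x y' :
  lact (emb_tauB (tensor_mk y x)) y' = ract y (emb_tauA (tensor_mk x y')).
Proof.
by apply: submod_val_inj; rewrite emb_tauAE emb_tauBE /= phi_mulXY mulgA.
Qed.

Definition emb_context : morita_context A S :=
  MoritaContext emb_tauA_map emb_tauB_map emb_assocX emb_assocY.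


(** If phi(A) X = X and X Y = phi(A), then phi(A) = X Y = phi(A) X Y, which is
    phi(A) phi(A). *)
Lemma emb_idemA : set_product (range phi) X = X ->
  set_product X Y = range phi -> idempotent_algebra A.
Proof.
move=> eX eXY; apply/seteqP; split=> // a _.
set AA := set_product _ _.
suff : (phi @` AA) (phi a) by case=> a' a'A /phi_inj <-.
have Wsub := image_submodule phi_lin (span_submodule _ : is_submodule AA).
have : range phi (phi a) by exists a.
rewrite -eXY; apply: span_min => // _ [x Xx [y Yy <-]].
have [_ Sr] := @mul_bilinear R S.
move: Xx; rewrite -eX.
apply: (span_min (preimage_submodule (Sr y) Wsub)).
move=> _ [_ [b _ <-] [x' Xx' <-]] /=.
have [c _ cE] : range phi (x' ** y) by apply/XY/set_product_in.
exists (b ** c); last by rewrite phi_mul cE mulgA.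
exact: set_product_in.
Qed.

(** A span computed in S of elements of X is the image of a span computed in the
    module X, because the inclusion is linear and injective; this turns the
    equations in S into unitality of the bimodules. *)
Lemma emb_X_unital : set_product (range phi) X = X ->
  set_product X [set: S] = X -> unital_bimodule emb_X.
Proof.
move=> eX eXS; have vl := @submod_val_linear _ _ X.
split; apply/seteqP; split=> // x _; set P := span_product _ _ _;
  suff [x' Px' /submod_val_inj <-] :
    (@submod_val _ _ X @` P) (submod_val x) by [];
  rewrite (image_span _ vl).
- have := submod_valP x; rewrite -[X in X _ -> _]eX; apply: span_sub.
  move=> _ [_ [a _ <-] [y /submod_surj[{}y <-] <-]].
  by exists (@lact _ _ _ emb_X a y) => //; exists a => //; exists y.
- have := submod_valP x; rewrite -[X in X _ -> _]eXS; apply: span_sub.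
  move=> _ [y /submod_surj[{}y <-] [s _ <-]].
  by exists (@ract _ _ _ emb_X y s) => //; exists y => //; exists s.
Qed.

Lemma emb_Y_unital : set_product [set: S] Y = Y ->
  set_product Y (range phi) = Y -> unital_bimodule emb_Y.
Proof.
move=> eSY eY; have vl := @submod_val_linear _ _ Y.
split; apply/seteqP; split=> // x _; set P := span_product _ _ _;
  suff [x' Px' /submod_val_inj <-] :
    (@submod_val _ _ Y @` P) (submod_val x) by [];
  rewrite (image_span _ vl).
- have := submod_valP x; rewrite -[X in X _ -> _]eSY; apply: span_sub.
  move=> _ [s _ [y /submod_surj[{}y <-] <-]].
  by exists (@lact _ _ _ emb_Y s y) => //; exists s => //; exists y.
- have := submod_valP x; rewrite -[X in X _ -> _]eY; apply: span_sub.
  move=> _ [y /submod_surj[{}y <-] [_ [a _ <-] <-]].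
  by exists (@ract _ _ _ emb_Y y a) => //; exists y => //; exists a.
Qed.

Lemma emb_tauA_surj : set_product X Y = range phi ->
  forall a, exists t, emb_tauA t = a.
Proof.
move=> eXY a.
have Wsub := image_submodule phi_lin
  (image_submodule emb_tauA_linear (submodule_setT _)).
suff [_ [t _ <-] /phi_inj <-] : (phi @` range emb_tauA) (phi a) by exists t.
have : range phi (phi a) by exists a.
rewrite -eXY; apply: (span_min Wsub).
move=> _ [x /submod_surj[{}x <-] [y /submod_surj[{}y <-] <-]].
exists (emb_tauA (tensor_mk (x : emb_X) (y : emb_Y))); first by eexists.
by rewrite emb_tauAE phi_mulXY.
Qed.

Lemma emb_tauB_surj : set_product Y X = [set: S] ->
  forall s, exists t, emb_tauB t = s.
Proof.
move=> eYX s.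
have Wsub := image_submodule emb_tauB_linear (submodule_setT _).
suff [t _ <-] : range emb_tauB s by exists t.
have : [set: S] s by [].
rewrite -eYX; apply: (span_min Wsub).
move=> _ [y /submod_surj[{}y <-] [x /submod_surj[{}x <-] <-]].
by exists (tensor_mk (y : emb_Y) (x : emb_X)) => //; rewrite emb_tauBE.
Qed.

End Embedding.

(** The sufficient condition for graded equivalence that is applied below; with
    phi the inclusion of e S e in S, X = e S and Y = S e it is the classical
    equivalence between a full corner and the whole algebra. *)
Theorem graded_equivalent_embedding (R : comPzRingType) (G : groupType)
    (A S : graded_algebra R G) (phi : A -> S) (X Y : submodule S) :
  linear phi -> (forall a b, phi (a ** b) = phi a ** phi b) ->
  injective phi ->
  (forall t a, ga_comp t (phi a) <-> ga_comp t a) ->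
  graded_submodule (@ga_comp R G S) X -> graded_submodule (@ga_comp R G S) Y ->
  set_product (range phi) X = X -> set_product X [set: S] = X ->
  set_product [set: S] Y = Y -> set_product Y (range phi) = Y ->
  set_product X Y = range phi -> set_product Y X = [set: S] ->
  graded_equivalent A S.
Proof.
move=> phi_lin phi_mul phi_inj phi_gr Xgr Ygr eX eXS eSY eY eXY eYX.
have sub (P Q : set S) : P = Q -> P `<=` Q by move=> ->.
pose M := emb_context phi_lin phi_mul phi_inj
  (sub _ _ eX) (sub _ _ eXS) (sub _ _ eSY) (sub _ _ eY) (sub _ _ eXY).
pose Xc t : set (mc_X M) := [set x | ga_comp t (submod_val x)].
pose Yc t : set (mc_Y M) := [set y | ga_comp t (submod_val y)].
have idA := emb_idemA phi_lin phi_mul phi_inj (sub _ _ eXY) eX eXY.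
(* S = Y X is contained in S S. *)
have idS : idempotent_algebra S.
  by apply/seteqP; split=> // s _; move: (I : [set: S] s); rewrite -{1}eYX;
    apply: set_product_sub.
have gX : graded_bimodule Xc.
  split=> [|r s a x ra sx|r s x b rx sb] /=.
  - exact: graded_submodule_direct (ga_direct S) Xgr.
  - by apply: ga_mul => //; apply/phi_gr.
  - exact: ga_mul.
have gY : graded_bimodule Yc.
  split=> [|r s b y rb sy|r s y a ry sa] /=.
  - exact: graded_submodule_direct (ga_direct S) Ygr.
  - exact: ga_mul.
  - by apply: ga_mul => //; apply/phi_gr.
have tA r s : mc_tauA (m := M) @` tensor_comp (Xc r) (Yc s)
    `<=` ga_comp (r * s)%g.
  rewrite image_span; last by case: (mc_tauA_map M).
  apply: span_min; first exact: (ga_direct A).1.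
  move=> _ [_ [x rx [y sy <-]] <-]; apply/phi_gr.
  have -> : phi (mc_tauA (m := M) (tensor_mk x y)) =
      submod_val x ** submod_val y by rewrite /= (emb_tauAE phi_inj) phi_mulXY.
  exact: ga_mul.
have tB r s : mc_tauB (m := M) @` tensor_comp (Yc r) (Xc s)
    `<=` ga_comp (r * s)%g.
  rewrite image_span; last by case: (mc_tauB_map M).
  apply: span_min; first exact: (ga_direct S).1.
  move=> _ [_ [y ry [x sx <-]] <-].
  by rewrite /= emb_tauBE; apply: ga_mul.
exists (GradedMoritaContext idA idS gX gY tA tB); split.
- exact: (emb_X_unital _ _ _ _ eX eXS).
- exact: (emb_Y_unital _ _ _ _ eSY eY).
- exact: emb_tauA_surj.
- exact: emb_tauB_surj.
Qed.

(** * Graded submodules of a direct sum, degree by degree *)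

Section Components.
Variables (R : pzRingType) (V : lmodType R) (I : choiceType).
Variable D : I -> submodule V.

Definition fill (E : I -> set V) : set (dsum D) :=
  [set f | forall t, E t (f t)].

Lemma fill_submodule (E : I -> set V) :
  (forall t, is_submodule (E t)) -> is_submodule (fill E).
Proof.
move=> Esub; split=> [t|a f g fE gE t].
  by have [] := Esub t.
by rewrite dsumLE; have [_] := Esub t; apply.
Qed.

Lemma dsum_delta (f : dsum D) : exists C : {fset I},
  f = \sum_(t <- C) delta (dsum_dom f t).
Proof.
have /finite_suppP[C fC] := dsum_supp f.
exists C; apply/dsumP => t; rewrite dsum_sumE.
have [tC|tC] := boolP (t \in C).
  rewrite (big_fsetD1 t)//= eqxx big_seq big1 ?addr0// => i.
  by rewrite !inE eq_sym => /andP[/negbTE ->].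
rewrite fC// big_seq big1// => i iC /=; case: eqP => // ti.
by rewrite ti iC in tC.
Qed.

(** The homogeneous component of degree i of a sum of homogeneous elements is
    the value at i of that sum. *)
Lemma fill_graded (E : I -> set V) (Esub : forall t, is_submodule (E t)) :
  graded_submodule (@homogeneous _ _ _ D) (Submodule (fill_submodule Esub)).
Proof.
move=> f /finite_suppP[C fC] fh fE i t; have [->|ti] := eqVneq t i; last first.
  by rewrite fh//; have [] := Esub t.
suff <- : (\sum_(j \in [set: I]) f j) i = f i i by apply: fE.
rewrite (fsbigTE _ _ fC) dsum_sumE.
have [iC|iC] := boolP (i \in C).
  rewrite (big_fsetD1 i)//= big_seq big1 ?addr0// => j.
  by rewrite !inE => /andP[ji _]; apply: fh; rewrite eq_sym.
rewrite fC// big_seq big1// => j jC; apply: fh.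
by apply: contraNneq iC => ->.
Qed.

End Components.

(** * Products of graded submodules in a global skew group algebra *)

Section SkewProducts.
Variables (R : comPzRingType) (G : groupType) (B : nualgType R).
Variable beta : global_action G B.

Local Notation S := (global_skew_algebra beta).

Lemma gskew_mulE r a b : gskew_mul beta r a b = a ** beta r b.
Proof. by rewrite /gskew_mul gact_mulM gact_mapVK. Qed.

(** The component of degree t of (sum E_r delta_r)(sum F_s delta_s). *)
Definition skew_conv (E F : G -> set B) (t : G) : set B :=
  span [set c | exists r a b,
    [/\ E r a, F (r^-1 * t)%g b & c = a ** beta r b]].

Lemma skew_conv_submodule (E F : G -> set B) t : is_submodule (skew_conv E F t).
Proof. exact: span_submodule. Qed.

Lemma in_skew_conv (E F : G -> set B) r t a b : E r a -> F (r^-1 * t)%g b ->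
  skew_conv E F t (a ** beta r b).
Proof. by move=> Ea Fb; apply: sub_span; exists r, a, b. Qed.

Lemma skew_conv_eq (E F : G -> set B) t (W : set B) : is_submodule W ->
  (forall r a b, E r a -> F (r^-1 * t)%g b -> W (a ** beta r b)) ->
  W `<=` skew_conv E F t -> skew_conv E F t = W.
Proof.
move=> Wsub EFW Wconv; apply/seteqP; split=> //; apply: (span_min Wsub).
by move=> _ [r [a [b [Ea Fb ->]]]]; apply: EFW.
Qed.

(** One inclusion expands the convolution product of S; for the other, a
    generator a beta_r(b) in degree t is the product of a delta_r and
    b delta_(r^-1 t). *)
Lemma fill_product (E F : G -> set B) :
  (forall t, is_submodule (E t)) -> (forall t, is_submodule (F t)) ->
  set_product (fill E : set S) (fill F) = fill (skew_conv E F).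
Proof.
move=> Esub Fsub; apply/seteqP; split.
  apply: span_min.
    by apply: fill_submodule => t; apply: span_submodule.
  move=> _ [f fE [g gF <-]] t.
  have /finite_suppP[C fC] := dsum_supp f.
  rewrite [X in skew_conv _ _ _ X]
    (twist_mul_funE (T := gskew_twist beta) g t fC).
  apply: (submodule_sum _ _ (span_submodule _)) => r; apply: sub_span.
  by exists r, (f r), (g (r^-1 * t)%g); split=> //; apply: gskew_mulE.
move=> h hEF; have [C ->] := dsum_delta h.
apply: (submodule_sum _ _ (span_submodule _)) => t.
pose d c : S := delta (D := @gskew_dom R G B) (t := t) (a := c) I.
have d_lin : linear d.
  move=> a u v; apply/dsumP => i; rewrite [RHS]dsumLE /=.
  by case: eqP => // _; rewrite scaler0 addr0.
(* [d c] is c delta_t as a linear function of c, so that generators suffice. *)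
have : skew_conv E F t (h t) by [].
rewrite [X in span _ X](_ : _ = d (h t)); last exact/dsumP.
apply: (span_min (preimage_submodule d_lin (span_submodule _))).
move=> _ [r [a [b [Ea Fb ->]]]].
pose f : S := delta (D := @gskew_dom R G B) (t := r) (a := a) I.
pose g : S := delta (D := @gskew_dom R G B) (t := (r^-1 * t)%g) (a := b) I.
apply: sub_span; exists f.
  by move=> i /=; case: eqP => [->//|_]; have [] := Esub i.
exists g; first by move=> i /=; case: eqP => [->//|_]; have [] := Fsub i.
rewrite [LHS](@twist_mul_delta _ _ _ (gskew_twist beta)); apply/dsumP => i /=.
by rewrite mulVKg gskew_mulE.
Qed.

End SkewProducts.

(** * The partial skew group algebra inside the global one *)

Section Globalization.
Variables (R : comPzRingType) (G : groupType) (A B : nualgType R).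
Variables (alpha : product_partial_action G A) (beta : global_action G B).
Variable iota : A -> B.
Hypothesis glob : is_globalization alpha beta iota.

Local Notation AG := (partial_skew_algebra alpha).
Local Notation BG := (global_skew_algebra beta).
Local Notation D := (ppa_dom alpha).
Local Notation al := (ppa_map alpha).
Local Notation J := (range iota).
Local Notation Jt t := (beta t @` range iota).

Lemma iota_linear : linear iota.
Proof. by case: glob => -[[il _] _] _ _ _ _ a u v; apply: il. Qed.

Lemma iota_mul a b : iota (a ** b) = iota a ** iota b.
Proof. by case: glob => -[[_ im] _] _ _ _ _; apply: im. Qed.

Lemma iota_inj : injective iota.
Proof. by case: glob => -[]. Qed.

Lemma iota_al t x : D t^-1%g x -> iota (al t x) = beta t (iota x).
Proof. by case: glob => _ _ _ _; apply. Qed.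

(** Both twisted products are a beta_r(b): alpha is the restriction of beta to
    the domains, and alpha_r^-1(a) b stays in the domain of alpha_r. *)
Lemma iota_skew_mul r a b : D r a ->
  iota (skew_mul alpha r a b) = gskew_mul beta r (iota a) (iota b).
Proof.
move=> Da; have Da' := ppa_in_domV Da.
rewrite /skew_mul /gskew_mul iota_al; last exact: ppa_mulr.
by rewrite iota_mul iota_al ?invgK.
Qed.

Fact skew_emb_supp (f : AG) : finite_supp (fun t => iota ((f : dsum _) t)).
Proof.
have /finite_suppP[C fC] := dsum_supp (f : dsum _).
by apply/finite_suppP; exists C => t /fC ->; exact: (linear_fun0 iota_linear).
Qed.

Definition skew_emb (f : AG) : BG :=
  dsum_mk (D := @gskew_dom R G B) (skew_emb_supp f) (fun=> I).

Lemma skew_emb_linear : linear skew_emb.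
Proof.
move=> a f g; apply/dsumP => t; rewrite [RHS]dsumLE /=.
by rewrite -iota_linear.
Qed.

Lemma skew_emb_mul f g : skew_emb (f ** g) = skew_emb f ** skew_emb g.
Proof.
apply/dsumP => t.
have /finite_suppP[C fC] := dsum_supp (f : dsum _).
rewrite [RHS](@twist_mul_funE _ _ _ (gskew_twist beta) _ _ C); last first.
  by move=> r /fC /= ->; exact: (linear_fun0 iota_linear).
rewrite /= (twist_mul_funE (T := skew_twist alpha) g t fC).
rewrite (linear_fun_sum _ _ iota_linear); apply: eq_bigr => r _ /=.
by apply: iota_skew_mul; apply: (dsum_dom f).
Qed.

Lemma skew_emb_inj : injective skew_emb.
Proof.
move=> f g fg; apply: dsumP => t; apply: iota_inj.
by rewrite -[LHS]/(skew_emb f t) fg.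
Qed.

Lemma skew_emb_homogeneous t f : ga_comp t (skew_emb f) <-> ga_comp t f.
Proof.
split=> fh i it; have := fh i it; last first.
  by move=> /= ->; exact: (linear_fun0 iota_linear).
by rewrite /= -(linear_fun0 iota_linear) => /iota_inj.
Qed.

(** Preimages under iota of the components of an element are unique, hence
    vanish with them: the chosen family has finite support. *)
Lemma range_skew_emb : range skew_emb = fill (fun t => iota @` D t).
Proof.
apply/seteqP; split=> [_ [f _ <-] t|h hD] /=.
  by exists ((f : dsum _) t) => //; apply: (dsum_dom f).
have gP t : exists a, D t a /\ iota a = h t.
  by have [a Da aE] := hD t; exists a.
pose g t := projT1 (cid (gP t)).
have gD t : D t (g t) by rewrite /g; case: cid => a [].
have gE t : iota (g t) = h t by rewrite /g; case: cid => a [].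
have gfin : finite_supp g.
  have /finite_suppP[C hC] := dsum_supp h.
  apply/finite_suppP; exists C => t /hC ht; apply: iota_inj.
  by rewrite gE ht (linear_fun0 iota_linear).
by exists (dsum_mk (D := skew_dom alpha) gfin gD) => //; apply/dsumP => t /=.
Qed.

Lemma beta_linear t : linear (beta t).
Proof. by move=> a u v; apply: gact_linear. Qed.

Lemma is_ideal_J : is_ideal J.
Proof. by case: glob => _ []. Qed.

(** beta_t is bijective, so b beta_t(j) = beta_t(beta_t^-1(b) j). *)
Lemma is_ideal_Jt t : is_ideal (Jt t).
Proof.
have [Jsub Jmul] := is_ideal_J.
split; first exact: (image_submodule (beta_linear t) Jsub).
move=> b _ [j Jj <-]; have [bJ Jb] := Jmul (beta t^-1%g b) j Jj.
by split; [exists (beta t^-1%g b ** j) | exists (j ** beta t^-1%g b)];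
  rewrite // gact_mulM gact_mapVK.
Qed.

Lemma Jt1 : Jt 1%g = J.
Proof.
by apply/seteqP; split=> [_ [j Jj <-]|j Jj]; [|exists j => //]; rewrite gact1.
Qed.

Lemma beta_Jt s t : beta s @` Jt t = Jt (s * t)%g.
Proof.
by rewrite image_comp; congr image; apply/funext => x; rewrite gactM.
Qed.

Lemma Jt_idem t : Jt t = span [set a ** b | a in Jt t & b in Jt t].
Proof.
have [_ [_ Jidem] _ _ _] := glob.
rewrite -{1}Jidem [LHS](image_span _ (beta_linear t)); congr span.
apply/seteqP; split.
  move=> _ [_ [a Ja [b Jb <-]] <-].
  rewrite gact_mulM; exists (beta t a); first by exists a.
  by exists (beta t b) => //; exists b.
move=> _ [_ [a Ja <-] [_ [b Jb <-] <-]].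
by exists (a ** b); [exists a => //; exists b|rewrite gact_mulM].
Qed.

Lemma beta_in_Jt r t b : Jt (r^-1 * t)%g b -> Jt t (beta r b).
Proof. by move=> Jb; rewrite -(mulVKg r t) -beta_Jt; exists b. Qed.

Lemma J_idem : J = span [set a ** b | a in J & b in J].
Proof. by have := Jt_idem 1%g; rewrite Jt1. Qed.

Lemma dom1_J : set_product J (Jt 1%g) = J.
Proof. by rewrite Jt1; case: glob => _ []. Qed.

(** * The six product equations, in degree t *)

(** The summands lie in J because J is an ideal; conversely the summand r = 1
    is (J J_1) J = J J, which is already J by idempotence. *)
Lemma conv_dom_J t :
  skew_conv beta (fun r => set_product J (Jt r)) (fun=> J) t = J.
Proof.
have [Jsub Jmul] := is_ideal_J.
apply: skew_conv_eq => // [r a b aP _|].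
  by have [] := Jmul (beta r b) a (set_product_subl is_ideal_J aP).
rewrite {1}J_idem; apply: (span_min (skew_conv_submodule _ _ _ _)).
move=> _ [a Ja [b Jb <-]].
by rewrite -(gact1 beta b); apply: in_skew_conv; rewrite ?dom1_J.
Qed.

(** Likewise the summand r = 1, which is J B, contains J J = J. *)
Lemma conv_J_full t : skew_conv beta (fun=> J) (fun=> [set: B]) t = J.
Proof.
have [Jsub Jmul] := is_ideal_J.
apply: skew_conv_eq => // [r a b Ja _|].
  by have [] := Jmul (beta r b) a Ja.
rewrite {1}J_idem; apply: (span_min (skew_conv_submodule _ _ _ _)).
move=> _ [a Ja [b Jb <-]].
by rewrite -(gact1 beta b); apply: in_skew_conv.
Qed.

(** Every summand is B J_t, and it contains J_t J_t = J_t. *)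
Lemma conv_full_Jt t : skew_conv beta (fun=> [set: B]) (fun r => Jt r) t = Jt t.
Proof.
have [Jsub Jmul] := is_ideal_Jt t.
apply: skew_conv_eq => // [r a b _ /beta_in_Jt Jb|].
  by have [] := Jmul a _ Jb.
rewrite {1}Jt_idem; apply: (span_min (skew_conv_submodule _ _ _ _)).
move=> _ [a Ja [b Jb <-]].
by rewrite -(gact1 beta b); apply: in_skew_conv; rewrite // invg1 mul1g.
Qed.

(** The summand r = t is J_t beta_t(J J_1) = J_t J_t. *)
Lemma conv_Jt_dom t :
  skew_conv beta (fun r => Jt r) (fun r => set_product J (Jt r)) t = Jt t.
Proof.
have [Jsub Jmul] := is_ideal_Jt t.
apply: skew_conv_eq => // [r a b _ /(set_product_subr (is_ideal_Jt _))|].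
  by move=> /beta_in_Jt Jb; have [] := Jmul a _ Jb.
rewrite {1}Jt_idem; apply: (span_min (skew_conv_submodule _ _ _ _)).
move=> _ [a Ja [_ [j Jj <-] <-]].
by apply: in_skew_conv; rewrite // mulVg dom1_J.
Qed.

(** Every summand is J beta_r(J_(r^-1 t)) = J J_t, whatever r is. *)
Lemma conv_J_Jt t :
  skew_conv beta (fun=> J) (fun r => Jt r) t = set_product J (Jt t).
Proof.
apply: skew_conv_eq => [|r a b Ja /beta_in_Jt Jb|]; first exact: span_submodule.
  exact: set_product_in.
apply: (span_min (skew_conv_submodule _ _ _ _)) => _ [a Ja [b Jb <-]].
by rewrite -(gact1 beta b); apply: in_skew_conv; rewrite // invg1 mul1g.
Qed.

(** The summand of index r is J_r beta_r(J) = J_r J_r = J_r, so the sum is that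
    of all the J_r: this is where minimality enters. *)
Lemma conv_Jt_J t : [set: B] = span (\bigcup_t Jt t) ->
  skew_conv beta (fun r => Jt r) (fun=> J) t = [set: B].
Proof.
move=> minB; apply: skew_conv_eq => //.
rewrite minB; apply: (span_min (skew_conv_submodule _ _ _ _)) => x [r _].
rewrite Jt_idem; apply: (span_min (skew_conv_submodule _ _ _ _)).
by move=> _ [a Ja [_ [j Jj <-] <-]]; apply: in_skew_conv.
Qed.

End Globalization.

Theorem theorem5p7 (k : comPzRingType) (G : groupType) (A B : nualgType k)
    (alpha : product_partial_action G A) (beta : global_action G B) :
  minimal_globalization alpha beta ->
  graded_equivalent (partial_skew_algebra alpha) (global_skew_algebra beta).
Proof.
move=> [iota [glob minB]].
have Jsub (t : G) := (is_ideal_J glob).1.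
have Jtsub t := (is_ideal_Jt glob t).1.
have domsub t := span_submodule
  [set a ** b | a in range iota & b in beta t @` range iota].
have Bsub (t : G) := @submodule_setT _ B.
have [_ _ _ iotaD _] := glob.
have rE : range (skew_emb glob) =
    fill (fun t => set_product (range iota) (beta t @` range iota)).
  by rewrite range_skew_emb; congr fill; apply/funext.
have TE : [set: global_skew_algebra beta] = fill (fun=> [set: B]).
  by apply/seteqP.
apply: (@graded_equivalent_embedding _ _ _ _ (skew_emb glob)
  (Submodule (@fill_submodule _ _ _ (@gskew_dom k G B) _ Jsub))
  (Submodule (@fill_submodule _ _ _ (@gskew_dom k G B) _ Jtsub))).
- exact: skew_emb_linear.
- exact: skew_emb_mul.
- exact: skew_emb_inj.
- exact: skew_emb_homogeneous.
- exact: fill_graded.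
- exact: fill_graded.
- rewrite rE fill_product//; congr fill; apply/funext => t.
  exact: (conv_dom_J glob).
- rewrite TE fill_product//; congr fill; apply/funext => t.
  exact: (conv_J_full glob).
- rewrite TE fill_product//; congr fill; apply/funext => t.
  exact: (conv_full_Jt glob).
- rewrite rE fill_product//; congr fill; apply/funext => t.
  exact: (conv_Jt_dom glob).
- rewrite rE fill_product//; congr fill; apply/funext => t.
  exact: conv_J_Jt.
- rewrite TE fill_product//; congr fill; apply/funext => t.
  exact: (conv_Jt_J glob).
Qed.
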